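(* Let $f:\mathbb{R}^d\to\mathbb{R}$ satisfy assumptions A1, A2, A3 stated in the context. Let $\beta \ge \frac{d}{2}$ and $\alpha \in \left(0,\frac12\right]\cap\left(0,\frac{2\beta}{d+3\beta}\right)$, and set $\varepsilon(t)=(1+t)^{-\alpha}$ for $t\ge 0$ and $$D_\varepsilon(\mathbf{x},t)=\big(f(\mathbf{x})-f_{\min}\big)^\beta+\varepsilon(t).$$ Let $u(\mathbf{x},t)$ be the $\Omega$-periodic solution of $$\partial_t u=\Delta\big(D_\varepsilon u\big)\ \text{ in } \mathbb{R}^d\times(0,+\infty),\qquad u(\mathbf{x},0)=u_0(\mathbf{x})\ \text{ in } \mathbb{R}^d,$$ with $\int_\Omega u(\mathbf{x},t)\,d\mathbf{x}=1$ for all $t\ge 0$, and, for each $t>0$, let $\bar u(\cdot,t)$ be the $\Omega$-periodic solution of $$\Delta\big(D_\varepsilon(\mathbf{x},t)\,\bar u(\mathbf{x},t)\big)=0,\qquad \int_\Omega \bar u(\mathbf{x},t)\,d\mathbf{x}=1 .$$ Then there exists $t_0>0$ such that for all $t>t_0$, $$\big\|u(\cdot,t)-\bar u(\cdot,t)\big\|_{L^2(\mu)}\lesssim t^{-\gamma},\qquad \gamma=1-\left(\frac{d}{2\beta}+\frac32\right)\alpha>0,$$ where $\|\cdot\|_{L^2(\mu)}$ is the weighted $L^2$ norm on $\Omega$ with the (time-dependent) measure $d\mu=D_\varepsilon(\mathbf{x},t)\,d\mathbf{x}$, i.e. $\|v\|_{L^2(\mu)}=\big(\int_\Omega v^2 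D_\varepsilon(\mathbf{x},t)\,d\mathbf{x}\big)^{1/2}$.
   Context: $\Omega\subset\mathbb{R}^d$ ($d\ge1$) is a $d$-dimensional cube with edge length $\ell_\Omega$. A function on $\mathbb{R}^d$ is called $\Omega$-periodic if $g(\mathbf{x}+\ell_\Omega\mathbf{e}_i)=g(\mathbf{x})$ for all $1\le i\le d$, where $\mathbf{e}_i$ is the unit vector in direction $i$. The initial datum $u_0$ is an $\Omega$-periodic probability density (nonnegative, $\int_\Omega u_0\,d\mathbf{x}=1$), and $u$ represents a probability distribution at each time. Assumptions on the objective function $f$: A1. $f$ is at least $C^2$ and is $\Omega$-periodic, with a unique global minimizer $\mathbf{x}_*\in\Omega$ and $f_{\min}:=f(\mathbf{x}_* )$. Moreover there is a gap $\mathfrak{g}>0$ between the global minimum value $f_{\min}$ and the values of the other local minima of $f$ (in $\Omega$). A2. There exist $r,a>0$ such that $f(\mathbf{x})-f_{\min}\le a|\mathbf{x}-\mathbf{x}_*|^2$ on $B_r(\mathbf{x}_* ):=\{\mathbf{x}\in\mathbb{R}^d:|\mathbf{x}-\mathbf{x}_*|<r\}\subset\Omega$. A3. There exists $b>0$ such that $f(\mathbf{x})-f_{\min}\ge b|\mathbf{x}-\mathbf{x}_*|^2$ for all $\mathbf{x}\in\Omega$. The notation $A(t)\lesssim B(t)$ means $A(t)\le C\,B(t)$ with a constant $C>0$ independent of $t$. *)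

(* Defs.v *)
From HB Require Import structures.
From mathcomp Require Import all_boot all_order all_algebra.
From mathcomp Require Import all_classical all_reals all_analysis.

Set Implicit Arguments.
Unset Strict Implicit.
Unset Printing Implicit Defensive.

Import Order.TTheory GRing.Theory Num.Theory.
Import numFieldNormedType.Exports.

Local Open Scope classical_set_scope.
Local Open Scope ring_scope.

(** The library has no Lebesgue measure on R^n.  It is built here on
    [n.-tuple R], which carries the product Borel sigma-algebra, as the image
    of the iterated product measure under [(x, s) |-> x :: s]. *)
Section lebesgue_tuple_step.
Context (R : realType) (n : nat).
Variable m : {sigma_finite_measure set (n.-tuple (measurableTypeR R)) -> \bar R}.

Definition tuple_cons (p : measurableTypeR R * n.-tuple (measurableTypeR R)) :
  n.+1.-tuple (measurableTypeR R) := [tuple of p.1 :: p.2].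

Definition tuple_uncons (s : n.+1.-tuple (measurableTypeR R)) :
  measurableTypeR R * n.-tuple (measurableTypeR R) :=
  (tnth s ord0, [tuple of behead s]).

Lemma measurable_tuple_cons : measurable_fun [set: _] tuple_cons.
Proof. exact: (measurable_cons (f := fst) (g := snd)). Qed.

Lemma measurable_tuple_uncons : measurable_fun [set: _] tuple_uncons.
Proof.
apply/measurable_fun_pairP; split.
- exact: (@measurable_tnth _ (measurableTypeR R) n.+1 ord0).
- exact: (@measurable_behead _ (measurableTypeR R) n).
Qed.

Lemma tuple_consK : cancel tuple_cons tuple_uncons.
Proof. by case=> x s; congr pair; apply/val_inj. Qed.

Lemma tuple_unconsK : cancel tuple_uncons tuple_cons.
Proof. by move=> s; rewrite [RHS]tuple_eta. Qed.

Definition lebesgue_cons : set (n.+1.-tuple (measurableTypeR R)) -> \bar R :=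
  pushforward (@lebesgue_measure R \x m)%E tuple_cons.

HB.instance Definition _ := Measure.copy lebesgue_cons
  (measure_function_pushforward__canonical__measure_function_Measure
     (@lebesgue_measure R \x m)%E measurable_tuple_cons).

Lemma lebesgue_cons_sigma_finite : sigma_finite setT lebesgue_cons.
Proof.
have /sigma_finiteP[F [TF ndF Foo]] := sigma_finiteT (@lebesgue_measure R).
have /sigma_finiteP[G [TG ndG Goo]] := sigma_finiteT m.
exists (fun i => tuple_uncons @^-1` (F i `*` G i)).
  rewrite predeqE => s; split=> // _.
  have [k _ Fk] : (\bigcup_k F k) (tuple_uncons s).1 by rewrite -TF.
  have [l _ Gl] : (\bigcup_k G k) (tuple_uncons s).2 by rewrite -TG.
  exists (maxn k l) => //; split.
  - by move: Fk; exact/subsetPset/ndF/leq_maxl.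
  - by move: Gl; exact/subsetPset/ndG/leq_maxr.
move=> i; have [mF Fi] := Foo i; have [mG Gi] := Goo i; split.
  rewrite -[X in measurable X]setTI; apply: measurable_tuple_uncons => //.
  exact: measurableX.
rewrite /lebesgue_cons /pushforward -comp_preimage.
rewrite (_ : _ \o _ = id); last by rewrite funeqE => p /=; rewrite tuple_consK.
by rewrite preimage_id product_measure1E// lte_mul_pinfty// ge0_fin_numE.
Qed.

HB.instance Definition _ :=
  Measure_isSigmaFinite.Build _ _ _ lebesgue_cons lebesgue_cons_sigma_finite.

End lebesgue_tuple_step.

Fixpoint lebesgue_tuple (R : realType) (n : nat) :
    {sigma_finite_measure set (n.-tuple (measurableTypeR R)) -> \bar R} :=
  match n with
  | 0 => dirac ([tuple] : 0.-tuple (measurableTypeR R))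
  | n'.+1 => lebesgue_cons (lebesgue_tuple R n')
  end.

Section periodic_problem.
Context (R : realType) (d : nat).
Implicit Types (x y : 'rV[R]_d) (g : 'rV[R]_d -> R).

Definition unit_vec (i : 'I_d) : 'rV[R]_d := delta_mx 0 i.

(** The norm of the library on ['rV[R]_d] is the sup norm. *)
Definition enorm x : R := Num.sqrt (\sum_i x 0 i ^+ 2).

(** The closed axis-parallel cube with edge length [l] and lowest corner [c]. *)
Definition cube (c : 'rV[R]_d) (l : R) : set 'rV[R]_d :=
  [set x | forall i, c 0 i <= x 0 i <= c 0 i + l].

Definition row_of_tuple (s : d.-tuple (measurableTypeR R)) : 'rV[R]_d :=
  \row_i tnth s i.

(** Borel measurability of a function on R^d, and its Lebesgue integral, both
    read through the identification of d-tuples with row vectors. *)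
Definition measurable_rV g : Prop :=
  measurable_fun [set: d.-tuple (measurableTypeR R)] (g \o row_of_tuple).

Definition integral_rV (A : set 'rV[R]_d) (g : 'rV[R]_d -> R) : \bar R :=
  (\int[lebesgue_tuple R d]_(s in row_of_tuple @^-1` A)
     (g (row_of_tuple s))%:E)%E.

Definition periodic (l : R) g : Prop :=
  forall i x, g (x + l *: unit_vec i) = g x.

Definition partial (i : 'I_d) g x : R := 'D_(unit_vec i) g x.

Definition C2 g : Prop :=
  [/\ continuous g,
      forall i x, derivable g x (unit_vec i),
      forall i, continuous (partial i g),
      forall i j x, derivable (partial i g) x (unit_vec j) &
      forall i j, continuous (partial j (partial i g))].

Definition laplacian g x : R := \sum_i partial i (partial i g) x.

Definition local_minimizer g x : Prop := \forall y \near x, g x <= g y.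

Definition probability_density (Om : set 'rV[R]_d) (l : R) g : Prop :=
  [/\ periodic l g, measurable_rV g, forall x, 0 <= g x &
      integral_rV Om g = 1%:E].

Definition assumption_A1 (Om : set 'rV[R]_d) (l : R)
    (f : 'rV[R]_d -> R) (xs : 'rV[R]_d) : Prop :=
  [/\ C2 f, periodic l f,
      [/\ Om xs, forall x, f xs <= f x &
          forall x, Om x -> (forall y, f x <= f y) -> x = xs] &
      exists2 gap : R, 0 < gap &
        forall x, Om x -> local_minimizer f x -> x <> xs -> gap <= f x - f xs].

Definition assumption_A2 (Om : set 'rV[R]_d) (f : 'rV[R]_d -> R)
    (xs : 'rV[R]_d) : Prop :=
  exists r a : R,
    [/\ 0 < r, 0 < a, [set x | enorm (x - xs) < r] `<=` Om &
        forall x, enorm (x - xs) < r -> f x - f xs <= a * enorm (x - xs) ^+ 2].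

Definition assumption_A3 (Om : set 'rV[R]_d) (f : 'rV[R]_d -> R)
    (xs : 'rV[R]_d) : Prop :=
  exists2 b : R, 0 < b &
    forall x, Om x -> b * enorm (x - xs) ^+ 2 <= f x - f xs.

Definition eps (alpha t : R) : R := (1 + t) `^ (- alpha).

Definition Deps (f : 'rV[R]_d -> R) (fmin beta alpha : R) (x : 'rV[R]_d) (t : R) : R :=
  (f x - fmin) `^ beta + eps alpha t.

Definition continuous_pos (v : 'rV[R]_d -> R -> R) : Prop :=
  forall x (t : R), 0 < t ->
    {for (x, t), continuous (fun p : 'rV[R]_d * R => v p.1 p.2)}.

(** Classical solutions of [u_t = Laplacian (D u)].  Only the product [D u],
    not [u], is twice differentiable in space: [D] itself need not be C^2.  The
    initial datum, a mere density, is attained in L^1 of one period. *)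
Record periodic_solution (Om : set 'rV[R]_d) (l : R)
    (D : 'rV[R]_d -> R -> R) (u0 : 'rV[R]_d -> R) (u : 'rV[R]_d -> R -> R) :
    Prop := {
  sol_periodic : forall t : R, 0 <= t -> periodic l (u ^~ t);
  sol_continuous : continuous_pos u;
  sol_derivable_t : forall x (t : R), 0 < t -> derivable (u x) t 1;
  sol_continuous_t : continuous_pos (fun x t => derive1 (u x) t);
  sol_C2 : forall t : R, 0 < t -> C2 (fun x => D x t * u x t);
  sol_continuous_x : forall i,
    continuous_pos (fun x t => partial i (fun y => D y t * u y t) x);
  sol_continuous_xx : forall i j,
    continuous_pos
      (fun x t => partial j (partial i (fun y => D y t * u y t)) x);
  sol_equation : forall x (t : R), 0 < t ->
    derive1 (u x) t = laplacian (fun y => D y t * u y t) x;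
  sol_initial : forall x, u x 0 = u0 x;
  sol_initial_cvg :
    integral_rV Om (fun x => `|u x t - u0 x|) @[t --> 0^'+] --> 0%E
}.

Record periodic_stationary_solution (Om : set 'rV[R]_d) (l : R)
    (D v : 'rV[R]_d -> R) : Prop := {
  stat_periodic : periodic l v;
  stat_C2 : C2 (fun x => D x * v x);
  stat_equation : forall x, laplacian (fun y => D y * v y) x = 0;
  stat_mass : integral_rV Om v = 1%:E
}.

(** The norm of [L^2(rho dx)] on [Om], as an extended real. *)
Definition weighted_L2 (Om : set 'rV[R]_d) (rho v : 'rV[R]_d -> R) : \bar R :=
  (integral_rV Om (fun x => (v x ^+ 2 * rho x)%R) `^ 2^-1)%E.

End periodic_problem.

(* Main.v *)
Require Import Defs.
From mathcomp Require Import all_boot all_order all_algebra.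
From mathcomp Require Import all_classical all_reals all_analysis.
From mathcomp Require Import measurable_realfun ring lra.

(** Write [D = F + eps].  Since [D ubar] is periodic and harmonic it is a
    constant [Z], so [ubar = Z / D] with [1 / Z] the integral of [1 / D], and the
    squared norm to bound is [E = int u^2 D - Z].  Multiplying the equation by
    [h = D u] and integrating by parts,
      [E' = - 2 int |grad h|^2 + eps' (int u^2 - Z^2 int 1 / D^2)].
    By the Poincare inequality and [D >= eps], the first term is at most
    [- 2 c0 eps E]; by Young's inequality, the second one is at most
    [c0 eps E + c1 eps'^2 / eps^4].  For [eps = (1 + t)^(-alpha)], a supersolution
    of this differential inequality gives [E <= M (1 + t)^(3 alpha - 2)], and
    [1 - 3 alpha / 2 >= gamma].

    For [t > 0] every integrand is continuous, so the integral over a cube is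
    treated as a positive linear functional on continuous functions, and the
    divergence theorem and the Poincare inequality are proved by induction on
    the dimension, integrating out the first coordinate. *)

Import Order.TTheory GRing.Theory Num.Theory.
Import numFieldNormedType.Exports.

Local Open Scope classical_set_scope.
Local Open Scope ring_scope.

Set Implicit Arguments.
Unset Strict Implicit.
Unset Printing Implicit Defensive.

(** * Integrals over cubes *)

Lemma continuous_pair_at (T U V : topologicalType) (f : T -> U) (g : T -> V) t :
  {for t, continuous f} -> {for t, continuous g} ->
  {for t, continuous (fun x => (f x, g x))}.
Proof. exact: (@cvg_pair _ _ _ (nbhs t) (nbhs (f t)) (nbhs (g t))). Qed.

(** * Splitting off the first coordinate of a vector *)

Section row_cons.
Context {R : realType} {d : nat}.
Implicit Types (x : R) (v : 'rV[R]_d) (w : 'rV[R]_d.+1).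

(** The vector counterpart of [tuple_cons]: [unlift ord0 i] is [None] only at the head, where [oapp]
    returns its default [x]. *)
Definition row_cons x v : 'rV[R]_d.+1 :=
  \row_i oapp (fun j => v 0 j) x (unlift ord0 i).

Definition row_behead w : 'rV[R]_d := \row_j w 0 (lift ord0 j).

Lemma row_cons0 x v : row_cons x v 0 ord0 = x.
Proof. by rewrite mxE unlift_none. Qed.

Lemma row_consS x v j : row_cons x v 0 (lift ord0 j) = v 0 j.
Proof. by rewrite mxE liftK. Qed.

Lemma row_of_tuple_cons x (s : d.-tuple (measurableTypeR R)) :
  row_of_tuple (tuple_cons (x, s)) = row_cons x (row_of_tuple s).
Proof.
apply/rowP => i; rewrite mxE; case: (unliftP ord0 i) => [j ->|->].
  by rewrite row_consS mxE tnthS.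
by rewrite row_cons0 tnth0.
Qed.

Lemma row_of_tupleE (s : d.+1.-tuple (measurableTypeR R)) :
  row_of_tuple s =
  row_cons (tuple_uncons s).1 (row_of_tuple (tuple_uncons s).2).
Proof. by rewrite -row_of_tuple_cons -{1}(tuple_unconsK s). Qed.

Lemma cube_cons (c : 'rV[R]_d.+1) l x v :
  cube c l (row_cons x v) <->
  c 0 ord0 <= x <= c 0 ord0 + l /\ cube (row_behead c) l v.
Proof.
split=> [H|[H0 H] i].
  split; first by have := H ord0; rewrite row_cons0.
  by move=> j; have := H (lift ord0 j); rewrite row_consS mxE.
case: (unliftP ord0 i) => [j ->|->]; last by rewrite row_cons0.
by rewrite row_consS; have := H j; rewrite mxE.
Qed.

Lemma row_cons_continuous :
  continuous (fun p : R * 'rV[R]_d => row_cons p.1 p.2).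
Proof.
move=> [x v]; apply/cvg_ballP => e e0; near=> p.
have [h1 [_ h2]] : ball x e p.1 /\ ball v e p.2.
  by near: p; exact: (@nbhsx_ballx _ _ (x, v)).
by split=> // i0 i; rewrite !mxE; case: (unliftP ord0 i) => [j _|_] //=.
Unshelve. all: by end_near. Qed.

Lemma row_cons_continuousr x : continuous (row_cons x).
Proof.
move=> v; apply: (@continuous_comp _ _ _ (pair x) (fun p => row_cons p.1 p.2)).
  by apply: continuous_pair_at; [exact: cst_continuous|exact: cvg_id].
exact: row_cons_continuous.
Qed.

Lemma row_cons_continuousl v : continuous (row_cons^~ v).
Proof.
move=> x; apply: (@continuous_comp _ _ _ (pair^~ v)
  (fun p => row_cons p.1 p.2)).
  by apply: continuous_pair_at; [exact: cvg_id|exact: cst_continuous].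
exact: row_cons_continuous.
Qed.

End row_cons.

(** * Joint measurability of functions continuous in one variable and measurable in the other *)

Section caratheodory.
Context {R : realType} {disp : measure_display} {T : measurableType disp}.

(** Rounding down to the mesh [1 / n.+1]: a function with countably many values, constant on
    half-open intervals. *)
Let grid (n : nat) (x : R) : R := (Num.floor (x * n.+1%:R))%:~R / n.+1%:R.

Let grid_cvg x : grid n x @[n --> \oo] --> x.
Proof.
apply/cvgrPdist_lt => e e0; near=> n.
have n0 : 0 < n.+1%:R :> R by rewrite ltr0n.
have h1 := floor_le (x * n.+1%:R).
have := floorD1_gt (x * n.+1%:R); rewrite intrD => h2.
have e1 : n.+1%:R^-1 < e.
  by near: n; exact: near_infty_natSinv_lt (PosNum e0).
have -> : x - grid n x = (x * n.+1%:R - (Num.floor (x * n.+1%:R))%:~R) / n.+1%:R.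
  by rewrite /grid mulrBl mulfK// gt_eqF.
rewrite ger0_norm; last by rewrite divr_ge0 ?subr_ge0.
apply: le_lt_trans e1; rewrite -[leRHS]mul1r ler_wpM2r ?invr_ge0 1?ltW//.
by rewrite ltrBlDl.
Unshelve. all: by end_near. Qed.

(* [h (grid n x) s] is measurable, being a countable patching in [x] of
   measurable functions of [s], and tends to [h x s]. *)
Lemma measurable_caratheodory (h : R -> T -> R) :
  (forall x, measurable_fun setT (h x)) -> (forall s, continuous (h^~ s)) ->
  measurable_fun setT (fun p : measurableTypeR R * T => h p.1 p.2).
Proof.
move=> mh ch.
have hcvg (x : R) s : h (grid n x) s @[n --> \oo] --> h x s.
  exact: (cvg_comp (grid^~ x) (h^~ s) (@grid_cvg x) (ch s x)).
apply: (measurable_fun_cvg (h := fun n (p : measurableTypeR R * T) =>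
  h (grid n p.1) p.2)).
  move=> n _ Y mY; rewrite setTI.
  have n0 : 0 < n.+1%:R :> R by rewrite ltr0n.
  (* [z] enumerates the integers through their coding in [nat]. An index that codes no integer gives
     [0], which merely repeats the strip of [0]. *)
  pose z (k : nat) : R := (odflt 0 (unpickle k : option int))%:~R.
  rewrite [X in measurable X](_ : _ = \bigcup_(k : nat)
     (`[z k / n.+1%:R, (z k + 1) / n.+1%:R[%classic `*`
     (h (z k / n.+1%:R) @^-1` Y))).
    apply: bigcupT_measurable => k; apply: measurableX => //.
    by rewrite -[X in measurable X]setTI; exact: mh.
  apply/seteqP; split=> [[x s] /= Yxs|[x s] [k _ []]] /=.
    exists (pickle (Num.floor (x * n.+1%:R))) => //=.
    rewrite /z pickleK /= in_itv /= ler_pdivrMr// ltr_pdivlMr//.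
    by rewrite floor_le -[1]/(1%:~R) -intrD floorD1_gt.
  rewrite in_itv /= ler_pdivrMr// ltr_pdivlMr// => /andP[zx xz].
  by rewrite /grid (@floor_def _ _ (odflt 0 (unpickle k))) // intrD zx.
by move=> [x s] _; exact: hcvg.
Qed.
End caratheodory.

(** * Measurability and integrability of continuous functions on cubes *)

Section cube_measure.
Context {R : realType}.

Lemma row0_eq (v w : 'rV[R]_0) : v = w.
Proof. by apply/rowP => -[]. Qed.

(** The sigma-algebra is the product one on tuples, so the proof goes by induction on the dimension:
    [g] is continuous in the first coordinate and, by induction, measurable in the others. *)
Lemma continuous_measurable_rV d (g : 'rV[R]_d -> R) :
  continuous g -> measurable_rV g.
Proof.
elim: d g => [|d IH] g cg.
  rewrite /measurable_rV (_ : _ \o _ = cst (g 0)); first exact: measurable_cst.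
  by apply/funext => s /=; congr g; exact: row0_eq.
rewrite /measurable_rV (_ : _ \o _ =
    (fun p : measurableTypeR R * d.-tuple (measurableTypeR R) =>
       g (row_cons p.1 (row_of_tuple p.2))) \o @tuple_uncons R d); last first.
  by apply/funext => s /=; rewrite row_of_tupleE.
apply: measurableT_comp (@measurable_tuple_uncons R d).
apply: (measurable_caratheodory
  (h := fun x (s : d.-tuple (measurableTypeR R)) =>
          g (row_cons x (row_of_tuple s)))).
  move=> x; apply: (IH (g \o row_cons x)) => v.
  by apply: continuous_comp; [exact: row_cons_continuousr|exact: cg].
move=> s x; apply: (@continuous_comp _ _ _ (row_cons^~ (row_of_tuple s)) g).
  exact: row_cons_continuousl.
exact: cg.
Qed.

Lemma preimage_cubeE d (c : 'rV[R]_d.+1) l :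
  @row_of_tuple R d.+1 @^-1` cube c l =
  @tuple_uncons R d @^-1` (`[c 0 ord0, c 0 ord0 + l]%classic `*`
    (@row_of_tuple R d @^-1` cube (row_behead c) l)).
Proof.
apply/seteqP; split=> s /=; rewrite row_of_tupleE in_itv /=.
  by move=> /cube_cons.
by move=> ?; apply/cube_cons.
Qed.

Lemma measurable_preimage_cube d (c : 'rV[R]_d) l :
  measurable (@row_of_tuple R d @^-1` cube c l).
Proof.
elim: d c => [|d IH] c.
  rewrite (_ : _ @^-1` _ = setT) //.
  by apply/seteqP; split=> // s _ [].
rewrite preimage_cubeE -[X in measurable X]setTI.
by apply: measurable_tuple_uncons => //; exact: measurableX.
Qed.

Lemma lebesgue_tuple_cube_lty d (c : 'rV[R]_d) l :
  (lebesgue_tuple R d (@row_of_tuple R d @^-1` cube c l) < +oo)%E.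
Proof.
elim: d c => [|d IH] c.
  by rewrite /= diracE ltry.
have fin : @lebesgue_measure R `[c 0 ord0, c 0 ord0 + l]%classic \is a fin_num.
  by rewrite lebesgue_measure_itv /=; case: ifP => // _; rewrite -EFinB.
rewrite preimage_cubeE /= /lebesgue_cons /pushforward -comp_preimage.
rewrite (_ : _ \o _ = id); last by apply/funext => p /=; rewrite tuple_consK.
rewrite preimage_id product_measure1E//; last exact: measurable_preimage_cube.
by apply: lte_mul_pinfty (IH _).
Qed.

Lemma cube_compact d (c : 'rV[R]_d) l : compact (cube c l).
Proof.
rewrite (_ : cube c l =
    [set v | forall i, `[c 0 i, c 0 i + l]%classic (v ord0 i)]).
  exact: (@rV_compact R d (fun i => `[c 0 i, c 0 i + l]%classic)
    (fun i => @segment_compact R _ _)).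
by apply/seteqP; split=> v /= H i; have := H i; rewrite /= in_itv.
Qed.

Lemma continuous_integrable_cube d (c : 'rV[R]_d) l (g : 'rV[R]_d -> R) :
  continuous g ->
  (lebesgue_tuple R d).-integrable (@row_of_tuple R d @^-1` cube c l)
    (EFin \o (g \o @row_of_tuple R d)).
Proof.
move=> cg; apply: measurable_bounded_integrable.
- exact: measurable_preimage_cube.
- exact: lebesgue_tuple_cube_lty.
- by apply: measurable_funTS; exact: continuous_measurable_rV.
have /compact_bounded[M [Mr HM]] : compact (g @` cube c l).
  apply: continuous_compact; last exact: cube_compact.
  exact: continuous_subspaceT.
exists M; split => // x Mx s /= Hs; apply: HM => //=.
by exists (row_of_tuple s).
Qed.

End cube_measure.

(** * The real-valued integral over a cube and Fubini's theorem *)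

Section cube_integral.
Context {R : realType}.

(** Taking [fine] loses nothing for a continuous integrand, whose integral is finite by
    [integral_rV_cubeE]. *)
Definition cube_integral d (c : 'rV[R]_d) (l : R) (g : 'rV[R]_d -> R) : R :=
  fine (integral_rV (cube c l) g).

Lemma integral_rV_cubeE d (c : 'rV[R]_d) l (g : 'rV[R]_d -> R) : continuous g ->
  integral_rV (cube c l) g = (cube_integral c l g)%:E.
Proof.
move=> cg; rewrite fineK//; apply: integrable_fin_num.
  exact: measurable_preimage_cube.
exact: (continuous_integrable_cube c l cg).
Qed.

Lemma cube_integralD d (c : 'rV[R]_d) l (g h : 'rV[R]_d -> R) :
  continuous g -> continuous h ->
  cube_integral c l (fun x => g x + h x) =
  cube_integral c l g + cube_integral c l h.
Proof.
move=> cg ch; apply: RintegralD.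
- exact: measurable_preimage_cube.
- exact: continuous_integrable_cube.
- exact: continuous_integrable_cube.
Qed.

Lemma cube_integralZ d (c : 'rV[R]_d) l (k : R) (g : 'rV[R]_d -> R) :
  continuous g ->
  cube_integral c l (fun x => k * g x) = k * cube_integral c l g.
Proof.
move=> cg; apply: RintegralZl.
- exact: measurable_preimage_cube.
- exact: continuous_integrable_cube.
Qed.

Lemma le_cube_integral d (c : 'rV[R]_d) l (g h : 'rV[R]_d -> R) :
  continuous g -> continuous h ->
  (forall x, cube c l x -> g x <= h x) ->
  cube_integral c l g <= cube_integral c l h.
Proof.
move=> cg ch gh; apply: le_Rintegral.
- exact: measurable_preimage_cube.
- exact: continuous_integrable_cube.
- exact: continuous_integrable_cube.
- by move=> s; exact: gh.
Qed.

(** In dimension 0 the measure is the Dirac mass at the empty tuple. This is the base case of the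
    inductions on the dimension. *)
Lemma cube_integral0 (c : 'rV[R]_0) l (g : 'rV[R]_0 -> R) : cube_integral c l g = g 0.
Proof.
rewrite /cube_integral /integral_rV (_ : _ @^-1` _ = setT); last first.
  by apply/seteqP; split=> // s _ [].
rewrite (eq_integral (cst (g 0)%:E)); last first.
  by move=> s _ /=; congr ((g _)%:E); exact: row0_eq.
have T1 : lebesgue_tuple R 0 setT = 1%E by exact: diracT.
rewrite integral_cst // -[RHS]/(fine (g 0)%:E) -[in RHS](mule1 (g 0)%:E).
by congr (fine (_ * _)%E); exact: T1.
Qed.

(** The measure in dimension [d.+1] is the image of a product measure under [tuple_cons]; a change
    of variables moves the integral to the product, where Fubini's theorem applies. This is the
    induction step for every result on cubes. *)
Lemma cube_integralS d (c : 'rV[R]_d.+1) l (g : 'rV[R]_d.+1 -> R) :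
  continuous g ->
  cube_integral c l g =
  \int[lebesgue_measure]_(x in `[c 0 ord0, c 0 ord0 + l])
    cube_integral (row_behead c) l (fun v => g (row_cons x v)).
Proof.
move=> cg; rewrite /cube_integral /Rintegral; congr fine.
pose A := `[c 0 ord0, c 0 ord0 + l]%classic : set (measurableTypeR R).
pose B := @row_of_tuple R d @^-1` cube (row_behead c) l.
pose G (p : measurableTypeR R * d.-tuple (measurableTypeR R)) : \bar R :=
  (g (row_cons p.1 (row_of_tuple p.2)))%:E.
have mA : measurable A by exact: measurable_itv.
have mB : measurable B by exact: measurable_preimage_cube.
have preE : @tuple_cons R d @^-1` (@row_of_tuple R d.+1 @^-1` cube c l) =
    A `*` B.
  rewrite preimage_cubeE -comp_preimage (_ : _ \o _ = id) ?preimage_id//.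
  by apply/funext => p /=; rewrite tuple_consK.
have mG : measurable_fun [set: measurableTypeR R * d.-tuple (measurableTypeR R)]
    (fun p => g (row_cons p.1 (row_of_tuple p.2))).
  rewrite (_ : (fun _ => _) = (g \o @row_of_tuple R d.+1) \o @tuple_cons R d).
    apply: measurableT_comp (@measurable_tuple_cons R d).
    exact: continuous_measurable_rV.
  by apply/funext => -[x s] /=; rewrite row_of_tuple_cons.
have iG : (@lebesgue_measure R \x lebesgue_tuple R d)%E.-integrable (A `*` B) G.
  apply: measurable_bounded_integrable.
  - exact: measurableX.
  - have := lebesgue_tuple_cube_lty c l.
    by rewrite /= /lebesgue_cons /pushforward preE.
  - by apply: measurable_funTS.
  have /compact_bounded[M [Mr HM]] : compact (g @` cube c l).
    apply: continuous_compact; last exact: cube_compact.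
    exact: continuous_subspaceT.
  exists M; split => // x Mx [y s] /= [Ay Bs]; apply: HM => //=.
  exists (row_cons y (row_of_tuple s)) => //.
  by apply/cube_cons; split => //; move: Ay; rewrite /A /= in_itv.
have step : integral_rV (cube c l) g =
    (\int[@lebesgue_measure R \x lebesgue_tuple R d]_(p in A `*` B) G p)%E.
  rewrite /integral_rV /=.
  rewrite (@integral_pushforward _ _ _ _ R _ (@measurable_tuple_cons R d)
    (@lebesgue_measure R \x lebesgue_tuple R d)%E).
  - rewrite preE; apply: eq_integral => -[x s] _ /=.
    by rewrite row_of_tuple_cons.
  - by apply/measurable_EFinP; exact: continuous_measurable_rV.
  - rewrite preE (_ : _ \o _ = G) //.
    by apply/funext => -[x s] /=; rewrite row_of_tuple_cons.
  - exact: measurable_preimage_cube.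
rewrite step [LHS]integral_mkcond.
(* Fubini's theorem is applied on the whole product space, so [G] is extended by zero outside [A]
   times [B], and the slices are then restricted back. *)
have iG' : (@lebesgue_measure R \x lebesgue_tuple R d)%E.-integrable setT
    (G \_ (A `*` B)).
  by apply/integrable_restrict; rewrite ?setTI//; exact: measurableX.
apply: (eq_trans (esym (integral12_prod_meas1 iG'))).
rewrite [RHS]integral_mkcond; apply: eq_integral => x _.
rewrite /fubini_F patchE; case: ifPn => [xA|xA]; last first.
  rewrite integral0_eq // => s _; rewrite patchE ifF//.
  apply/negP => /set_mem [Ax _]; move/negP: xA; apply; exact/mem_set.
rewrite -[RHS]integral_rV_cubeE; last first.
  move=> v; apply: continuous_comp; [exact: row_cons_continuousr|exact: cg].
rewrite /integral_rV [RHS]integral_mkcond; apply: eq_integral => s _.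
rewrite !patchE; case: ifPn => [/set_mem[_ Bs]|nAB]; first by rewrite ifT ?inE.
rewrite ifF//; apply/negP => /set_mem Bs; move/negP: nAB; apply.
by apply/mem_set; split => //; exact/set_mem.
Qed.
End cube_integral.

(** * The cube integral as a positive linear functional *)

Section pointwise_continuity.
Context {R : realType} {T : topologicalType}.
Implicit Types (f g : T -> R) (t : T).

Lemma continuous_at_cst (k : R) t : continuous_at t (fun _ : T => k).
Proof. exact: cvg_cst. Qed.

Lemma continuous_atD f g t : continuous_at t f -> continuous_at t g ->
  continuous_at t (fun x => f x + g x).
Proof. exact: cvgD. Qed.

Lemma continuous_atN f t : continuous_at t f -> continuous_at t (fun x => - f x).
Proof. exact: cvgN. Qed.

Lemma continuous_atM f g t : continuous_at t f -> continuous_at t g ->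
  continuous_at t (fun x => f x * g x).
Proof. exact: cvgM. Qed.

Lemma continuous_atV f t : f t != 0 -> continuous_at t f ->
  continuous_at t (fun x => (f x)^-1).
Proof. exact: cvgV. Qed.

Lemma continuous_atX f n t : continuous_at t f -> continuous_at t (fun x => f x ^+ n).
Proof. by move=> cf; exact: (continuous_comp cf (@exprn_continuous R n _)). Qed.

Lemma continuous_at_sum (I : finType) (F : I -> T -> R) t :
  (forall i, continuous_at t (F i)) ->
  continuous_at t (fun x => \sum_i F i x).
Proof.
move=> cF; apply: cvg_big => [|i _]; last exact: cF.
exact: add_continuous.
Qed.

End pointwise_continuity.

(* Proves continuity of an arithmetic expression from that of its atoms. *)
Ltac cont :=
  cbv beta;
  first
  [ match goal with
    | H : forall y, @continuous_at _ _ y ?f |- @continuous_at _ _ ?x ?f =>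
        exact (H x)
    | H : ?P |- ?P => exact H
    end
  | lazymatch goal with
    | |- prop_for _ _ => red; cont
    | |- forall _, _ => let x := fresh "x" in intro x; cont
    | |- continuous_at ?x (fun _ => ?k) => exact (@continuous_at_cst _ _ k x)
    | |- continuous_at ?x (fun y => @?f y + @?g y) =>
        refine (@continuous_atD _ _ f g x _ _); cont
    | |- continuous_at ?x (fun y => - @?f y) => refine (@continuous_atN _ _ f x _); cont
    | |- continuous_at ?x (fun y => @?f y * @?g y) =>
        refine (@continuous_atM _ _ f g x _ _); cont
    | |- continuous_at ?x (fun y => @?f y ^+ ?n) =>
        refine (@continuous_atX _ _ f n x _); cont
    | |- continuous_at ?x (fun y => ?f y) => change (continuous_at x f); cont
    | |- _ => try match goal with
        | H : continuous_at _ _ |- _ => exact H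
        | H : prop_for _ _ |- _ => exact H
        | H : forall _, continuous_at _ _ |- _ => exact (H _)
        | H : forall _ _, continuous_at _ _ |- _ => exact (H _ _)
        | H : forall _ _ _, continuous_at _ _ |- _ => exact (H _ _ _)
        | |- continuous_at ?x _ => refine (@continuous_at_sum _ _ _ _ x _); cont
        end
    end
  ].

Section cube_integral_functional.
Context {R : realType} {d : nat}.
Variables (c : 'rV[R]_d) (l : R).
Implicit Types (g h : 'rV[R]_d -> R) (k : R).
Local Notation I := (cube_integral c l).

Lemma eq_cube_integral g h : (forall x, g x = h x) -> I g = I h.
Proof. by move=> gh; congr cube_integral; apply/funext. Qed.

Lemma cube_integralN g : continuous g -> I (fun x => - g x) = - I g.
Proof.
move=> cg; rewrite -mulN1r -cube_integralZ//.
by apply: eq_cube_integral => x; rewrite mulN1r.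
Qed.

Lemma cube_integralB g h : continuous g -> continuous h ->
  I (fun x => g x - h x) = I g - I h.
Proof. by move=> cg ch; rewrite cube_integralD ?cube_integralN//; cont. Qed.

Lemma cube_integral_cst0 : I (fun=> 0) = 0.
Proof.
rewrite -[RHS](mul0r (I (fun=> 0))) -cube_integralZ; last cont.
by apply: eq_cube_integral => x; rewrite mul0r.
Qed.

Lemma cube_integral_sum n (F : 'I_n -> 'rV[R]_d -> R) :
  (forall i, continuous (F i)) ->
  I (fun x => \sum_i F i x) = \sum_i I (F i).
Proof.
elim: n F => [|n IH] F cF.
  rewrite big_ord0 -[RHS]cube_integral_cst0.
  by apply: eq_cube_integral => x; rewrite big_ord0.
rewrite big_ord_recl -IH; last by move=> i; exact: cF.
rewrite -cube_integralD; try by cont.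
by apply: eq_cube_integral => x; rewrite big_ord_recl.
Qed.

Lemma cube_integral_ge0 g : continuous g ->
  (forall x, cube c l x -> 0 <= g x) -> 0 <= I g.
Proof.
by move=> cg g0; rewrite -cube_integral_cst0; apply: le_cube_integral => //; cont.
Qed.

End cube_integral_functional.

(** Makes linearity and monotonicity of cube integrals available for integrals over an interval. *)
Lemma Rintegral_cube1 {R : realType} (a l : R) (F : R -> R) : continuous F ->
  \int[lebesgue_measure]_(x in `[a, a + l]) F x =
  cube_integral (\row_(_ < 1) a) l (fun v => F (v 0 ord0)).
Proof.
move=> cF; rewrite cube_integralS.
  rewrite mxE; apply: eq_Rintegral => x _.
  by rewrite cube_integral0 row_cons0.
move=> v; apply: (@continuous_comp _ _ _ (fun v : 'rV[R]_1 => v 0 ord0) F).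
  exact: coord_continuous.
exact: cF.
Qed.

(** * Estimates involving the volume of the cube *)

Section cube_integral_volume.
Context {R : realType}.
Variable l : R.
Hypothesis l0 : 0 < l.

Lemma cube_integral_cst d (c : 'rV[R]_d) (k : R) :
  cube_integral c l (fun=> k) = k * l ^+ d.
Proof.
elim: d c => [|d IH] c; first by rewrite cube_integral0 mulr1.
rewrite cube_integralS; last by move=> x; exact: continuous_at_cst.
under eq_Rintegral do rewrite IH.
rewrite Rintegral_cst; last exact: measurable_itv.
rewrite exprSr mulrA -[in RHS](_ : fine l%:E = l)//; congr (_ * fine _).
have -> : l%:E = (@lebesgue_measure R) `[c 0 ord0, c 0 ord0 + l]%classic.
  by rewrite lebesgue_measure_itv /= lte_fin ltrDl l0 -EFinB addrAC subrr add0r.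
by [].
Qed.

(** Uniform closeness on the cube is how limits are passed under the integral sign below, in place
    of dominated convergence. *)
Lemma cube_integral_dist d (c : 'rV[R]_d) (g h : 'rV[R]_d -> R) (e : R) :
  continuous g -> continuous h ->
  (forall x, cube c l x -> `|g x - h x| <= e) ->
  `|cube_integral c l g - cube_integral c l h| <= e * l ^+ d.
Proof.
move=> cg ch H; rewrite -cube_integralB// -(cube_integral_cst c).
have cgh : continuous (fun x => g x - h x) by cont.
rewrite ler_norml -cube_integralN; last by cont.
apply/andP; split; apply: le_cube_integral => //; try by cont.
- by move=> x /H; rewrite ler_norml => /andP[].
- by move=> x /H; rewrite ler_norml => /andP[].
Qed.

(* [0 <= I((V g - I g)^2) = V (V I(g^2) - (I g)^2)] with [V = l^d]. *)
Lemma cube_integral_sqr_le d (c : 'rV[R]_d) (g : 'rV[R]_d -> R) : continuous g ->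
  cube_integral c l g ^+ 2 <= l ^+ d * cube_integral c l (fun x => g x ^+ 2).
Proof.
move=> cg; set V := l ^+ d; set m := cube_integral c l g.
have V0 : 0 < V by exact: exprn_gt0.
have : 0 <= cube_integral c l
    (fun x => V ^+ 2 * g x ^+ 2 + (- (2 * V * m)) * g x + m ^+ 2).
  apply: cube_integral_ge0 => [|x _]; first by cont.
  by rewrite (_ : _ + _ = (V * g x - m) ^+ 2) ?sqr_ge0//; ring.
rewrite !cube_integralD; try by cont.
rewrite !cube_integralZ; try by cont.
rewrite cube_integral_cst -/V -/m.
set q := cube_integral _ _ _; move=> H.
rewrite -subr_ge0 -(pmulr_rge0 _ V0); apply: le_trans H _.
by rewrite le_eqVlt; apply/orP; left; apply/eqP; ring.
Qed.

End cube_integral_volume.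

(** * Integrals depending on a parameter *)

Definition jointly_continuous_at {R : realType} {d : nat}
    (g : 'rV[R]_d -> R -> R) (t : R) : Prop :=
  forall x, {for (x, t), continuous (fun p : 'rV[R]_d * R => g p.1 p.2)}.

Section integral_with_parameter.
Context {R : realType} {d : nat}.
Variables (c : 'rV[R]_d) (l : R).
Hypothesis l0 : 0 < l.
Implicit Types (g : 'rV[R]_d -> R -> R) (t s : R).

Lemma jointly_continuous_atl g t : jointly_continuous_at g t ->
  continuous (g^~ t).
Proof.
move=> cg x; apply: (@continuous_comp _ _ _ (pair^~ t) (fun p => g p.1 p.2)).
  by apply: continuous_pair_at; [exact: cvg_id|exact: cst_continuous].
exact: cg.
Qed.

(** Compactness of the cube turns the neighbourhoods given by joint continuity at each [(x, t)] into
    one neighbourhood of [t] valid for all [x]. *)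
Lemma near_cube_dist g t (e : R) : 0 < e -> jointly_continuous_at g t ->
  \forall s \near t, forall x, cube c l x -> `|g x s - g x t| <= e.
Proof.
move=> e0 cg.
have /compact_near_coveringP := @cube_compact R d c l.
move/(_ _ (nbhs t) (fun s x => `|g x s - g x t| <= e)).
apply => x _.
(* Near [(x, t)], both [g y s] and [g y t] are within [e / 2] of [g x t]. *)
have e20 : 0 < e / 2 by lra.
have /cvgrPdist_le/(_ _ e20) h := cg x.
have /cvgrPdist_le/(_ _ e20) h' := jointly_continuous_atl cg (x := x).
case: h => -[/= U V] [Ux Vt] UV.
exists (U `&` [set y | `|g x t - g y t| <= e / 2], V) => /=.
  by split=> //; exact: filterI.
move=> -[y s] [/= [Uy gy] Vs].
have := UV (y, s) (conj Uy Vs) => /= h1.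
rewrite (_ : g y s - g y t = (g x t - g y t) - (g x t - g y s)); last ring.
by apply: le_trans (ler_normB _ _) _; lra.
Qed.

Lemma cube_integral_continuous g t :
  (\forall s \near t, jointly_continuous_at g s) ->
  {for t, continuous (fun s => cube_integral c l (g^~ s))}.
Proof.
move=> ng; apply/cvgrPdist_le => e e0.
have V0 : 0 < l ^+ d by exact: exprn_gt0.
have gt := nbhs_singleton ng.
have e'0 : 0 < e / l ^+ d by rewrite divr_gt0.
have := near_cube_dist e'0 gt.
apply: filter_app; near=> s => H.
rewrite distrC -[e](divfK (lt0r_neq0 V0)); apply: cube_integral_dist => //.
  by apply: jointly_continuous_atl; near: s.
exact: jointly_continuous_atl.
Unshelve. all: by end_near. Qed.

Lemma is_derive1_cvg (F : R -> R) t (L : R) :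
  h^-1 * (F (t + h) - F t) @[h --> 0^'] --> L -> is_derive t 1 F L.
Proof.
move=> H.
have H' : h^-1 *: ((F \o shift t) (h *: 1) - F t) @[h --> 0^'] --> L.
  rewrite (_ : (fun h => _) = (fun h => h^-1 * (F (t + h) - F t))) //.
  by apply/funext => h; rewrite /= [h *: 1]mulr1 (addrC h).
by apply: DeriveDef; [apply/cvg_ex; exists L|exact/cvg_lim].
Qed.

(** By the mean value theorem, the difference quotient of [g x] is [g' x xi] with [xi] between [t]
    and [t + h]; [near_cube_dist] makes this close to [g' x t] uniformly in [x]. *)
Lemma cube_integral_derive g g' t :
  (\forall s \near t, jointly_continuous_at g s) ->
  jointly_continuous_at g' t ->
  (\forall s \near t, forall x, is_derive (s : R) (1 : R) (g x) (g' x s)) ->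
  is_derive t 1 (fun s => cube_integral c l (g^~ s)) (cube_integral c l (g'^~ t)).
Proof.
move=> ng ng' dg; apply: is_derive1_cvg; apply/cvgrPdist_le => e e0.
have V0 : 0 < l ^+ d by exact: exprn_gt0.
have gt := nbhs_singleton ng.
have e'0 : 0 < e / l ^+ d by rewrite divr_gt0.
have : \forall s \near t, [/\ jointly_continuous_at g s,
    forall x, is_derive (s : R) (1 : R) (g x) (g' x s) &
    forall x, cube c l x -> `|g' x s - g' x t| <= e / l ^+ d].
  by near=> s; split; near: s => //; exact: near_cube_dist.
move=> /nbhs_ballP[r /= r0 Hr].
near=> h.
have h0 : h != 0 by near: h; exact: nbhs_dnbhs_neq.
have hr : `|h| < r by near: h; exact: dnbhs0_lt.
have inball s : `|s - t| <= `|h| -> ball t r s.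
  by move=> H; rewrite /ball /= distrC; exact: le_lt_trans hr.
have cgh : continuous (g^~ (t + h)).
  apply: jointly_continuous_atl; have [] // := Hr (t + h); apply: inball.
  by rewrite addrAC subrr add0r.
have cgt := jointly_continuous_atl gt.
have cg't := jointly_continuous_atl ng'.
rewrite -cube_integralB// -cube_integralZ; last by cont.
rewrite distrC -[e](divfK (lt0r_neq0 V0)).
apply: cube_integral_dist => //; first by cont.
move=> x Kx.
have D s : `|s - t| <= `|h| -> is_derive s 1 (g x) (g' x s).
  by move=> /inball /Hr [].
(* The mean value theorem is stated on an ordered segment, hence the two cases on the sign of
   [h]. *)
have [xi Hxi ->] : exists2 xi, `|xi - t| <= `|h| & g x (t + h) - g x t = g' x xi * h.
  have cts s : `|s - t| <= `|h| -> continuous_at s (g x).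
    by move=> /D ?; apply/differentiable_continuous/derivable1_diffP.
  have [h_gt0|h_le0] := ltP 0 h.
    have [|||xi] := @MVT_segment R (g x) (g' x) t (t + h).
    - by rewrite lerDl ltW.
    - move=> s; rewrite in_itv /= => /andP[s1 s2]; apply: D.
      by rewrite !gtr0_norm//; lra.
    - apply: continuous_in_subspaceT => s; rewrite inE /= in_itv /= => /andP[s1 s2].
      apply: cts; rewrite (gtr0_norm h_gt0) ger0_norm//; lra.
    rewrite in_itv /= => /andP[s1 s2] ->; exists xi; last by rewrite addrAC subrr add0r.
    rewrite (gtr0_norm h_gt0) ger0_norm//; lra.
  have [|||xi] := @MVT_segment R (g x) (g' x) (t + h) t.
  - by rewrite gerDl.
  - move=> s; rewrite in_itv /= => /andP[s1 s2]; apply: D.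
    by rewrite !ler0_norm//; lra.
  - apply: continuous_in_subspaceT => s; rewrite inE /= in_itv /= => /andP[s1 s2].
    apply: cts; rewrite !ler0_norm//; lra.
  rewrite in_itv /= => /andP[s1 s2] E; exists xi.
    by rewrite !ler0_norm//; lra.
  by rewrite -opprB E; ring.
rewrite mulrC mulfK//.
by have [_ _] := Hr xi (inball _ Hxi); exact.
Unshelve. all: by end_near. Qed.

End integral_with_parameter.

(** * Fundamental theorem of calculus and Poincare inequality on an interval *)

Section one_dimensional.
Context {R : realType}.
Implicit Types (F G : R -> R) (a b l : R).
Local Notation J a b F := (\int[@lebesgue_measure R]_(x in `[a, b]) F x).

Lemma is_derive1_continuous F (F' : R -> R) :
  (forall x : R, is_derive x (1 : R) F (F' x)) -> continuous F.
Proof.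
by move=> dF x; have := dF x => ?; apply/differentiable_continuous/derivable1_diffP.
Qed.

Lemma Rintegral_derive F (F' : R -> R) a b : a <= b ->
  (forall x : R, is_derive x (1 : R) F (F' x)) -> continuous F' ->
  J a b F' = F b - F a.
Proof.
move=> ab dF cF'; have cF := is_derive1_continuous dF.
move: ab; rewrite le_eqVlt => /predU1P[<-|ab].
  by rewrite set_itv1 Rintegral_set1 subrr.
rewrite /Rintegral (continuous_FTC2 (F := F) ab) //.
- exact: continuous_subspaceT.
- split.
  + by move=> x _; have := dF x => ?; exact: ex_derive.
  + by apply: cvg_at_right_filter; exact: cF.
  + by apply: cvg_at_left_filter; exact: cF.
- by move=> x _; have := dF x => ?; rewrite derive1E derive_val.
Qed.

Lemma continuous_row1 F : continuous F ->
  continuous (fun v : 'rV[R]_1 => F (v 0 ord0)).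
Proof.
move=> cF v; apply: (@continuous_comp _ _ _ (fun v : 'rV[R]_1 => v 0 ord0) F).
  exact: coord_continuous.
exact: cF.
Qed.

Lemma continuous_integrable1 F a b : continuous F ->
  (@lebesgue_measure R).-integrable `[a, b] (EFin \o F).
Proof.
move=> cF; apply: continuous_compact_integrable; first exact: segment_compact.
exact: continuous_subspaceT.
Qed.

(** For any constant [k], the left-hand side is [l] times the integral of [(F - k)^2], minus
    [(int F - l k)^2]. The choice [k = F a] allows the integrand to be bounded through [F']. *)
Lemma poincare1 F (F' : R -> R) a l : 0 < l ->
  (forall x : R, is_derive x (1 : R) F (F' x)) -> continuous F' ->
  l * J a (a + l) (fun x => F x ^+ 2) - J a (a + l) F ^+ 2 <=
  l ^+ 3 * J a (a + l) (fun x => F' x ^+ 2).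
Proof.
move=> l0 dF cF'; have cF := is_derive1_continuous dF.
set S := J a (a + l) (fun x => F' x ^+ 2).
have S0 : 0 <= S by apply: Rintegral_ge0 => x _; exact: sqr_ge0.
have cF'2 : continuous (fun x => F' x ^+ 2) by cont.
(* [F x - F a] is the integral of [F'] over [[a, x]]; Cauchy-Schwarz bounds its square, and the
   interval is then enlarged to [[a, a + l]]. *)
have dist x : a <= x <= a + l -> (F x - F a) ^+ 2 <= l * S.
  move=> /andP[]; rewrite le_eqVlt => /predU1P[<- _|ax xl].
    by rewrite subrr expr0n mulr_ge0// ltW.
  have k0 : 0 < x - a by lra.
  have := cube_integral_sqr_le k0 (\row_(_ < 1) a) (continuous_row1 cF').
  rewrite -(Rintegral_cube1 a (x - a) cF') -(Rintegral_cube1 a (x - a) cF'2).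
  rewrite (_ : a + (x - a) = x); last ring.
  rewrite (Rintegral_derive (ltW ax) dF cF') expr1 => /le_trans; apply.
  apply: (@le_trans _ _ ((x - a) * S)); last by rewrite ler_wpM2r//; lra.
  apply: ler_wpM2l; first exact: ltW.
  rewrite /S /Rintegral fine_le//.
  - by apply: integrable_fin_num => //; exact: continuous_integrable1.
  - by apply: integrable_fin_num => //; exact: continuous_integrable1.
  apply: ge0_subset_integral => //.
  - exact: measurable_int (continuous_integrable1 _ _ cF'2).
  - by move=> y _; rewrite lee_fin sqr_ge0.
  - by apply: subset_itvl; rewrite bnd_simp; lra.
set V := J a (a + l) F.
have ca : continuous (fun _ : R => F a) by cont.
rewrite !Rintegral_cube1//; try by cont.
set I := cube_integral _ _.
have VE : V = I (fun v => F (v 0 ord0)) by rewrite /V Rintegral_cube1.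
have cF1 := continuous_row1 cF.
have : I (fun v => (F (v 0 ord0) - F a) ^+ 2) <= l * S * l.
  rewrite -[l in leRHS]expr1 -(cube_integral_cst l0 (\row_(_ < 1) a)).
  apply: le_cube_integral; [by cont|by cont|] => v /(_ ord0).
  by rewrite mxE => /dist.
have -> : I (fun v => (F (v 0 ord0) - F a) ^+ 2) =
   I (fun v => F (v 0 ord0) ^+ 2) - 2 * F a * V + F a ^+ 2 * l.
  rewrite -[l in RHS]expr1 -(cube_integral_cst l0 (\row_(_ < 1) a)).
  rewrite VE -cube_integralZ// -cube_integralB; try by cont.
  rewrite -cube_integralD; try by cont.
  by apply: eq_cube_integral => v; ring.
set q := I _; move=> H.
have : l * (q - 2 * F a * V + F a ^+ 2 * l) <= l * (l * S * l).
  by rewrite ler_pM2l.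
have : 0 <= (V - l * F a) ^+ 2 by exact: sqr_ge0.
nra.
Qed.

End one_dimensional.

(** * Divergence theorem and Poincare inequality *)

Section row_cons_derivatives.
Context {R : realType} {d : nat}.
Implicit Types (g : 'rV[R]_d.+1 -> R) (x h : R) (v : 'rV[R]_d) (j : 'I_d).

Lemma row_cons_addS h j x v :
  h *: unit_vec R (lift ord0 j) + row_cons x v =
  row_cons x (h *: unit_vec R j + v).
Proof.
apply/rowP => i; rewrite !mxE.
case: (unliftP ord0 i) => [k ->|->] /=; rewrite ?eqxx /=; last first.
  by rewrite mulr0 add0r.
by rewrite !mxE !eqxx /= (inj_eq lift_inj).
Qed.

Lemma row_cons_add0 h x v :
  h *: unit_vec R ord0 + row_cons x v = row_cons (h + x) v.
Proof.
apply/rowP => i; rewrite !mxE.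
case: (unliftP ord0 i) => [k ->|->] /=; rewrite ?eqxx /=; last by rewrite mulr1.
by rewrite mulr0 add0r.
Qed.

(** Equality of the difference quotients as functions of [h] transfers both derivability and the
    value of the derivative to slices. *)
Lemma quotient_row_consS g j x v :
  (fun h : R => h^-1 *: ((g \o shift (row_cons x v))
    (h *: unit_vec R (lift ord0 j)) - g (row_cons x v))) =
  (fun h : R => h^-1 *: (((fun v => g (row_cons x v)) \o shift v)
    (h *: unit_vec R j) - g (row_cons x v))).
Proof. by apply/funext => h /=; rewrite row_cons_addS. Qed.

Lemma partial_row_consS g j x v :
  partial (lift ord0 j) g (row_cons x v) =
  partial j (fun v => g (row_cons x v)) v.
Proof. by rewrite /partial /derive quotient_row_consS. Qed.

Lemma derivable_row_consS g j x v :
  derivable g (row_cons x v) (unit_vec R (lift ord0 j)) ->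
  derivable (fun v => g (row_cons x v)) v (unit_vec R j).
Proof. by rewrite /derivable quotient_row_consS. Qed.

Lemma is_derive_row_cons0 g x v :
  derivable g (row_cons x v) (unit_vec R ord0) ->
  is_derive x (1 : R) (fun x => g (row_cons x v)) (partial ord0 g (row_cons x v)).
Proof.
move=> dg.
have E : (fun h : R => h^-1 *: ((g \o shift (row_cons x v)) (h *: unit_vec R ord0)
    - g (row_cons x v))) =
    (fun h : R => h^-1 *: (((fun x => g (row_cons x v)) \o shift x) (h *: 1)
    - g (row_cons x v))).
  by apply/funext => h /=; rewrite row_cons_add0 [h *: 1]mulr1.
apply: DeriveDef; first by move: dg; rewrite /derivable E.
by rewrite /partial /derive E.
Qed.

Lemma row_cons_jointly_continuous g x : continuous g ->
  jointly_continuous_at (fun v x => g (row_cons x v)) x.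
Proof.
move=> cg v.
apply: (@continuous_comp _ _ _ (fun p : 'rV[R]_d * R => row_cons p.2 p.1) g);
  last exact: cg.
apply: (@continuous_comp _ _ _ (fun p : 'rV[R]_d * R => (p.2, p.1))
  (fun p => row_cons p.1 p.2)); last exact: row_cons_continuous.
by apply: continuous_pair_at; [exact: cvg_snd|exact: cvg_fst].
Qed.

Lemma continuous_row_cons g x : continuous g ->
  continuous (fun v => g (row_cons x v)).
Proof.
move=> cg v; apply: (@continuous_comp _ _ _ (row_cons x) g) (cg _).
exact: row_cons_continuousr.
Qed.

End row_cons_derivatives.

Section poincare_divergence.
Context {R : realType}.
Variable l : R.
Hypothesis l0 : 0 < l.

Definition C1 d (g : 'rV[R]_d -> R) : Prop :=
  [/\ continuous g, forall i x, derivable g x (unit_vec R i) &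
      forall i, continuous (partial i g)].

Lemma cube_integral_row_cons_continuous d (c : 'rV[R]_d) (g : 'rV[R]_d.+1 -> R) :
  continuous g -> continuous (fun x => cube_integral c l (fun v => g (row_cons x v))).
Proof.
move=> cg x; apply: (@cube_integral_continuous _ _ c l l0 (fun v x => g (row_cons x v))).
by near=> y; exact: row_cons_jointly_continuous.
Unshelve. all: by end_near. Qed.

Lemma cube_integral_row_cons_derive d (c : 'rV[R]_d) (g : 'rV[R]_d.+1 -> R) x :
  continuous g -> (forall x, derivable g x (unit_vec R ord0)) ->
  continuous (partial ord0 g) ->
  is_derive (x : R) (1 : R) (fun x => cube_integral c l (fun v => g (row_cons x v)))
    (cube_integral c l (fun v => partial ord0 g (row_cons x v))).
Proof.
move=> cg dg cg'.
apply: (@cube_integral_derive _ _ c l l0 (fun v x => g (row_cons x v))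
  (fun v x => partial ord0 g (row_cons x v))).
- by near=> y; exact: row_cons_jointly_continuous.
- exact: row_cons_jointly_continuous.
- by near=> y => v; exact: is_derive_row_cons0.
Unshelve. all: by end_near. Qed.

(** Along the first coordinate, the partial integral over the others is a function of one variable
    whose increment over a period vanishes. Along any other coordinate, the induction hypothesis
    applies to each slice. *)
Lemma cube_integral_partial0 d (c : 'rV[R]_d) (g : 'rV[R]_d -> R) i :
  Defs.periodic l g -> continuous g -> (forall x, derivable g x (unit_vec R i)) ->
  continuous (partial i g) -> cube_integral c l (partial i g) = 0.
Proof.
elim: d c g i => [c g []//|d IH] c g i pg cg dg cg'.
rewrite cube_integralS//; case: (unliftP ord0 i) => [j ij|i0]; subst i.
  have I0 x : cube_integral (row_behead c) l
      (fun v => partial (lift ord0 j) g (row_cons x v)) = 0.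
    rewrite (eq_cube_integral _ _ (fun v => partial_row_consS g j x v)).
    apply: IH.
    - move=> k v; rewrite -[RHS](pg (lift ord0 k)) [in RHS]addrC.
      by rewrite row_cons_addS [in RHS]addrC.
    - exact: continuous_row_cons.
    - by move=> v; exact: derivable_row_consS.
    - rewrite (_ : partial j _ = fun v => partial (lift ord0 j) g (row_cons x v)).
        exact: continuous_row_cons.
      by apply/funext => v; rewrite partial_row_consS.
  under eq_Rintegral do rewrite I0.
  by rewrite Rintegral_cst ?mul0r//; exact: measurable_itv.
have dH x := cube_integral_row_cons_derive (row_behead c) x cg dg cg'.
have al : c 0 ord0 <= c 0 ord0 + l by rewrite lerDl ltW.
rewrite (Rintegral_derive al dH (cube_integral_row_cons_continuous cg')).
apply/eqP; rewrite subr_eq0; apply/eqP/eq_cube_integral => v.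
by rewrite -[RHS](pg ord0) [in RHS]addrC row_cons_add0 addrC.
Qed.

Lemma Rintegral_sum_cube n (F : 'I_n -> R -> R) a : (forall i, continuous (F i)) ->
  \int[lebesgue_measure]_(x in `[a, a + l]) (\sum_i F i x) =
  \sum_i \int[lebesgue_measure]_(x in `[a, a + l]) (F i x).
Proof.
move=> cF; rewrite Rintegral_cube1; last by cont.
rewrite cube_integral_sum.
  by apply: eq_bigr => i _; rewrite Rintegral_cube1//; exact: cF.
by move=> i; exact: continuous_row1.
Qed.

(** [K] is chosen before the corner [c] and the function [h], so one constant serves all times in
    the energy estimate. The induction combines the inequality on each slice with [poincare1] for
    the slice integrals [H]. *)
Lemma poincare d : exists2 K : R, 0 <= K &
  forall (c : 'rV[R]_d) (h : 'rV[R]_d -> R), C1 h ->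
  l ^+ d * cube_integral c l (fun x => h x ^+ 2) - cube_integral c l h ^+ 2 <=
  K * \sum_i cube_integral c l (fun x => partial i h x ^+ 2).
Proof.
elim: d => [|d [K K0 IH]].
  exists 0 => // c h _.
  by rewrite !cube_integral0 mul1r subrr mul0r.
(* The first term comes from [poincare1] for [H] together with Cauchy-Schwarz for [H'], the second
   from the slices. *)
exists (l ^+ 3 * l ^+ d + l * K).
  by rewrite addr_ge0// mulr_ge0// ?exprn_ge0// ltW.
move=> c h [ch dh cdh].
have ch2 : continuous (fun x => h x ^+ 2) by cont.
have cdh2 i : continuous (fun x => partial i h x ^+ 2) by have := cdh i; cont.
set a := c 0 ord0; set c' := row_behead c.
pose H x := cube_integral c' l (fun v => h (row_cons x v)).
pose H' x := cube_integral c' l (fun v => partial ord0 h (row_cons x v)).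
have dH x : is_derive (x : R) (1 : R) H (H' x).
  by apply: cube_integral_row_cons_derive => // y; exact: dh.
have cH' : continuous H' by apply: cube_integral_row_cons_continuous; exact: cdh.
have cH : continuous H by exact: cube_integral_row_cons_continuous.
pose q x := cube_integral c' l (fun v => h (row_cons x v) ^+ 2).
pose D i x := cube_integral c' l (fun v => partial i h (row_cons x v) ^+ 2).
have cq : continuous q by exact: (cube_integral_row_cons_continuous ch2).
have cD i : continuous (D i).
  exact: (cube_integral_row_cons_continuous (cdh2 i)).
pose J (F : R -> R) := \int[lebesgue_measure]_(x in `[a, a + l]) F x.
have slice x : l ^+ d * q x <= H x ^+ 2 + K * \sum_j D (lift ord0 j) x.
  rewrite -lerBlDl (_ : \sum_j D (lift ord0 j) x = \sum_j cube_integral c' l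
      (fun v => partial j (fun v => h (row_cons x v)) v ^+ 2)); last first.
    apply: eq_bigr => j _; apply: eq_cube_integral => v.
    by rewrite partial_row_consS.
  apply: IH; split; first exact: continuous_row_cons.
    by move=> j v; exact: derivable_row_consS.
  move=> j; rewrite (_ : partial j _ =
      fun v => partial (lift ord0 j) h (row_cons x v)).
    by apply: continuous_row_cons; exact: cdh.
  by apply/funext => v; rewrite partial_row_consS.
have JE i : cube_integral c l (fun x => partial i h x ^+ 2) = J (D i).
  exact: (cube_integralS c l (cdh2 i)).
rewrite big_ord_recl; under eq_bigr do rewrite JE.
rewrite JE (cube_integralS c l ch2).
rewrite (cube_integralS c l ch) -/a -/c' -/(J q) -/(J H).
have mJ : measurable (`[a, a + l]%classic : set R) by exact: measurable_itv.
have ci F : continuous F -> (@lebesgue_measure R).-integrable `[a, a + l] (EFin \o F).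
  exact: continuous_integrable1.
pose SD x := \sum_j D (lift ord0 j) x.
have cSD : continuous SD.
  move=> x; apply: (@continuous_at_sum R _ _ (fun j => D (lift ord0 j))) => j.
  exact: cD.
have cKSD : continuous (fun x => K * SD x) by cont.
have cH2 : continuous (fun x => H x ^+ 2) by cont.
have cH'2 : continuous (fun x => H' x ^+ 2) by cont.
have cr : continuous (fun x => H x ^+ 2 + K * SD x) by cont.
have cl (F : R -> R) : continuous F -> continuous (fun x => l ^+ d * F x).
  by move=> cF; cont.
have JZ (k : R) (F : R -> R) : continuous F -> k * J F = J (fun x => k * F x).
  by move=> cF; rewrite -RintegralZl//; exact: ci.
have JS : \sum_j J (D (lift ord0 j)) = J SD by rewrite -Rintegral_sum_cube.
have J1 : l ^+ d * J q <= J (fun x => H x ^+ 2) + K * \sum_j J (D (lift ord0 j)).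
  rewrite JS !JZ// -RintegralD//; try exact: ci.
  by apply: le_Rintegral => //; apply: ci => //; exact: cl.
have J2 : J (fun x => H' x ^+ 2) <= l ^+ d * J (D ord0).
  rewrite JZ//; apply: le_Rintegral => //.
  - exact: ci.
  - by apply: ci; apply: cl.
  - move=> x _; apply: cube_integral_sqr_le => //.
    exact: (continuous_row_cons (cdh _)).
have J3 := poincare1 a l0 dH cH'; rewrite -/(J _) -/(J H) -/(J _) in J3.
have SJ0 : 0 <= \sum_j J (D (lift ord0 j)).
  apply: sumr_ge0 => j _; apply: Rintegral_ge0 => x _.
  apply: cube_integral_ge0 => [|v _]; last exact: sqr_ge0.
  exact: (continuous_row_cons (g := fun y => partial _ h y ^+ 2)).
have J00 : 0 <= J (D ord0).
  apply: Rintegral_ge0 => x _.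
  apply: cube_integral_ge0 => [|v _]; last exact: sqr_ge0.
  exact: (continuous_row_cons (g := fun y => partial _ h y ^+ 2)).
have ld0 : 0 < l ^+ d by exact: exprn_gt0.
have l30 : 0 < l ^+ 3 by exact: exprn_gt0.
move: J1 J2 J3 SJ0 J00; rewrite (exprS l d); move: l30 ld0.
set L := l ^+ d; set t := l ^+ 3 => l30 ld0.
set S := \sum_j _; set JD := J (D ord0); set Jq := J q; set JH2 := J _.
set JH'2 := J _ => J1 J2 J3 S0 JD0.
have := ler_wpM2l (ltW l0) J1; have := ler_wpM2l (ltW l30) J2.
(* These two nonnegative cross terms are what is added by multiplying all partial derivatives by the
   same constant. *)
have := mulr_ge0 (mulr_ge0 (ltW l30) (ltW ld0)) S0.
have := mulr_ge0 (mulr_ge0 (ltW l0) K0) JD0.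
lra.
Qed.

End poincare_divergence.

(** * Integration by parts and periodic harmonic functions *)

Section elliptic.
Context {R : realType} {d : nat}.
Variables (c : 'rV[R]_d) (l : R).
Hypothesis l0 : 0 < l.
Implicit Types (g h q : 'rV[R]_d -> R).
Local Notation I := (cube_integral c l).

Lemma periodic_partial g i : Defs.periodic l g -> Defs.periodic l (partial i g).
Proof.
move=> pg j x; rewrite /partial /derive.
rewrite (_ : (fun s : R => _) =
  (fun s : R => s^-1 *: ((g \o shift x) (s *: unit_vec R i) - g x))) //.
by apply/funext => s /=; rewrite addrA !pg.
Qed.

Lemma is_derive_partial g x i : derivable g x (unit_vec R i) ->
  is_derive x (unit_vec R i) g (partial i g x).
Proof. by move=> ?; apply: DeriveDef. Qed.

Lemma C2_C1 g : C2 g -> C1 g.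
Proof. by case=> cg dg cdg _ _; split. Qed.

Lemma C2_laplacian_continuous g : C2 g -> continuous (laplacian g).
Proof. by case=> _ _ _ _ cdd; rewrite /laplacian; cont. Qed.

(** Each [h * partial i h] is periodic, so the integral of its [i]-th partial derivative vanishes;
    the product rule splits that derivative into the two integrands. *)
Lemma cube_integral_laplacian h : C2 h -> Defs.periodic l h ->
  I (fun x => h x * laplacian h x) = - \sum_i I (fun x => partial i h x ^+ 2).
Proof.
move=> [ch dh cdh ddh cddh] ph.
have parts i : I (fun x => h x * partial i (partial i h) x) =
    - I (fun x => partial i h x ^+ 2).
  have D x : is_derive x (unit_vec R i) (fun x => h x * partial i h x)
      (h x * partial i (partial i h) x + partial i h x ^+ 2).
    have := is_deriveM (is_derive_partial (dh i x)) (is_derive_partial (ddh i i x)).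
    by rewrite /GRing.scale /= -expr2.
  have E : partial i (fun x => h x * partial i h x) =
      fun x => h x * partial i (partial i h) x + partial i h x ^+ 2.
    by apply/funext => x; rewrite /partial; have := D x => ?; rewrite derive_val.
  have ch1 : continuous (fun x => h x * partial i (partial i h) x).
    by have := cddh i i; cont.
  have ch2 : continuous (fun x => partial i h x ^+ 2) by have := cdh i; cont.
  have := @cube_integral_partial0 _ l l0 d c (fun x => h x * partial i h x) i.
  rewrite E cube_integralD// => H; apply/eqP; rewrite -addr_eq0; apply/eqP/H.
  - by move=> j x; rewrite ph (periodic_partial i ph).
  - by have := cdh i; cont.
  - by move=> x; have := D x => ?; exact: ex_derive.
  - by move=> x; apply: continuous_atD; [exact: ch1|exact: ch2].
rewrite -sumrN; under [RHS]eq_bigr do rewrite -parts.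
rewrite -cube_integral_sum; last by move=> i; have := cddh i i; cont.
by apply: eq_cube_integral => x; rewrite /laplacian mulr_sumr.
Qed.

(** The integral of [(k g + q)^2] is then affine in [k] and nonnegative for every [k], so its slope
    vanishes. This allows [g] to be dropped under the integral without proving that it vanishes
    pointwise. *)
Lemma cube_integral_sqr_eq0 g q : continuous g -> continuous q ->
  I (fun x => g x ^+ 2) = 0 -> I (fun x => g x * q x) = 0.
Proof.
move=> cg cq g0; apply/eqP; apply/negPn/negP => s0.
set s := I (fun x => g x * q x) in s0.
set r := I (fun x => q x ^+ 2).
have H k : 0 <= 2 * k * s + r.
  have : 0 <= I (fun x => (k * g x + q x) ^+ 2).
    by apply: cube_integral_ge0 => [|x _]; [cont|exact: sqr_ge0].
  rewrite (eq_cube_integral _ _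
    (h := fun x => k ^+ 2 * g x ^+ 2 + 2 * k * (g x * q x) + q x ^+ 2)).
    rewrite !cube_integralD; try by cont.
    by rewrite !cube_integralZ ?g0 ?mulr0 ?add0r; try by cont.
  by move=> x; ring.
(* This value of [k] makes the affine function equal to [-1]. *)
have := H (- (r + 1) / (2 * s)).
rewrite (_ : 2 * _ * s = - (r + 1)); last by field.
lra.
Qed.

(** Integrating [k] times its Laplacian shows that the gradient has zero norm, and the Poincare
    inequality then gives zero variance; [m] is the mean of [k]. Constancy in the mean-square sense
    suffices, as only integrals of [k] are needed. *)
Lemma periodic_harmonic_cst k : C2 k -> Defs.periodic l k ->
  (forall x, laplacian k x = 0) ->
  exists m, I (fun x => (k x - m) ^+ 2) = 0.
Proof.
move=> k2 pk lk; have [K K0 /(_ c k (C2_C1 k2))] := poincare l0 d.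
have := cube_integral_laplacian k2 pk.
rewrite (eq_cube_integral _ _ (h := fun=> 0)); last by move=> x; rewrite lk mulr0.
rewrite cube_integral_cst0 => /esym/eqP; rewrite oppr_eq0 => /eqP ->.
rewrite mulr0; set V := l ^+ d; set m := I k => H.
have V0 : 0 < V by exact: exprn_gt0.
have ck : continuous k by case: k2.
exists (m / V); apply/eqP; rewrite eq_le; apply/andP; split; last first.
  by apply: cube_integral_ge0 => [|x _]; [cont|exact: sqr_ge0].
rewrite (eq_cube_integral _ _
  (h := fun x => k x ^+ 2 + (- (2 * (m / V))) * k x + (m / V) ^+ 2)); last first.
  by move=> x; ring.
rewrite !cube_integralD; try by cont.
rewrite cube_integralZ; last by cont.
rewrite (cube_integral_cst l0) -/m -/V -(pmulr_rle0 _ V0).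
apply: le_trans H; rewrite le_eqVlt; apply/orP; left; apply/eqP.
by field; rewrite gt_eqF.
Qed.

End elliptic.

(** * Energy estimate *)

Section energy.
Context {R : realType} {d : nat}.
Implicit Types (s t : R) (x : 'rV[R]_d).
Variables (c : 'rV[R]_d) (l : R) (F : 'rV[R]_d -> R) (e e' : R -> R).
Variables (u0 : 'rV[R]_d -> R) (u : 'rV[R]_d -> R -> R).
Hypotheses (l0 : 0 < l) (cF : continuous F) (F0 : forall x, 0 <= F x).
Hypothesis pF : Defs.periodic l F.
Hypothesis e_gt0 : forall t, 0 < t -> 0 < e t.
Hypothesis e_le1 : forall t, 0 < t -> e t <= 1.
Hypothesis de : forall t, 0 < t -> is_derive (t : R) (1 : R) e (e' t).
Hypothesis ce' : forall t, 0 < t -> {for t, continuous e'}.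
Hypothesis e'_lt0 : forall t, 0 < t -> e' t < 0.
Let D x t := F x + e t.
Hypothesis su : periodic_solution (cube c l) l D u0 u.
Local Notation I := (cube_integral c l).
Hypothesis mass : forall t, 0 < t -> I (u^~ t) = 1.
Let V := l ^+ d.
Let h t := fun x => D x t * u x t.
Let Z t := (I (fun x => (D x t)^-1))^-1.
(** This is the squared weighted distance from [u] to the equilibrium [Z / D], as [E_sqr] shows; the
    present form is easier to differentiate in time. *)
Definition relative_energy t := I (fun x => u x t ^+ 2 * D x t) - Z t.
Let E := relative_energy.

Let V0 : 0 < V. Proof. exact: exprn_gt0. Qed.

Let D_gt0 x t : 0 < t -> 0 < D x t.
Proof. by move=> t0; rewrite ltr_wpDl// e_gt0. Qed.

Let cD t : continuous (D^~ t).
Proof. by rewrite /D; cont. Qed.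

Let cDV t : 0 < t -> continuous (fun x => (D x t)^-1).
Proof. by move=> t0 x; apply: continuous_atV; [rewrite gt_eqF// D_gt0|exact: cD]. Qed.

Let ce t : 0 < t -> continuous_at t e.
Proof. by move=> /de ?; apply/differentiable_continuous/derivable1_diffP. Qed.

Let jF x t : continuous_at (x, t) (fun p : 'rV[R]_d * R => F p.1).
Proof. by apply: (@continuous_comp _ _ _ fst F); [exact: cvg_fst|exact: cF]. Qed.

Let je x t : 0 < t -> continuous_at (x, t) (fun p : 'rV[R]_d * R => e p.2).
Proof.
move=> t0; apply: (@continuous_comp _ _ _ snd e); first exact: cvg_snd.
exact: ce.
Qed.

Let je' x t : 0 < t -> continuous_at (x, t) (fun p : 'rV[R]_d * R => e' p.2).
Proof.
move=> t0; apply: (@continuous_comp _ _ _ snd e'); first exact: cvg_snd.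
exact: ce'.
Qed.

Let jD t : 0 < t -> jointly_continuous_at D t.
Proof. by move=> t0 x; have := @je x t t0; rewrite /D; cont. Qed.

Let ju t : 0 < t -> jointly_continuous_at u t.
Proof. by move=> t0 x; exact: (sol_continuous su). Qed.

Let ju' t : 0 < t -> jointly_continuous_at (fun x t => derive1 (u x) t) t.
Proof. by move=> t0 x; exact: (sol_continuous_t su). Qed.

Let cu t : 0 < t -> continuous (u^~ t).
Proof. by move=> t0; exact/jointly_continuous_atl/ju. Qed.

Let dD x t : 0 < t -> is_derive (t : R) (1 : R) (D x) (e' t).
Proof.
move=> t0; have := de t0 => ?; rewrite -[e' t]add0r.
exact: (is_deriveD (f := cst (F x))).
Qed.

Let du x t : 0 < t -> is_derive (t : R) (1 : R) (u x) (derive1 (u x) t).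
Proof.
move=> t0; apply: DeriveDef; last by rewrite derive1E.
exact: (sol_derivable_t su).
Qed.

Let near_pos (t : R) (P : R -> Prop) : 0 < t -> (forall s, 0 < s -> P s) ->
  \forall s \near t, P s.
Proof. by move=> t0 H; near=> s; apply: H; near: s; exact: lt_nbhsr.
Unshelve. all: by end_near. Qed.

Let dIuuD t : 0 < t ->
  is_derive (t : R) (1 : R) (fun t => I (fun x => u x t ^+ 2 * D x t))
   (I (fun x => 2 * (h t x * laplacian (h t) x) + u x t ^+ 2 * e' t)).
Proof.
move=> t0.
(* The time derivative given by the product rule; the equation turns [D u] times the time derivative
   of [u] into [h] times its Laplacian. *)
pose g' x t := u x t ^+ 2 * e' t + D x t * (2 * (u x t * derive1 (u x) t)).
rewrite (eq_cube_integral _ _ (h := g'^~ t)); last first.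
  by move=> x; rewrite /g' (sol_equation su) // /h; ring.
apply: (@cube_integral_derive _ _ c l l0 (fun x t => u x t ^+ 2 * D x t) g').
- apply: near_pos t0 _ => s s0 x.
  have := @ju s s0 x; have := @jD s s0 x. cont.
- move=> x; rewrite /g'; have := @ju t t0 x; have := @jD t t0 x; have := @je' x t t0.
  by have := @ju' t t0 x; cont.
- apply: near_pos t0 _ => s s0 x; rewrite /g'.
  have := is_deriveM (is_deriveX 2 (du x s0)) (dD x s0).
  by rewrite /GRing.scale /= expr1 -[2 * _ * _]mulrA exprfctE.
Qed.

Let dIDV t : 0 < t ->
  is_derive (t : R) (1 : R) (fun t => I (fun x => (D x t)^-1))
   (- e' t * I (fun x => (D x t)^-2)).
Proof.
move=> t0.
have cD2 s : 0 < s -> continuous (fun x => (D x s)^-2).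
  move=> s0 x; apply: continuous_atV; first by rewrite expf_neq0// gt_eqF// D_gt0.
  by have := @cD s; cont.
rewrite -cube_integralZ; last exact: cD2.
apply: (@cube_integral_derive _ _ c l l0 (fun x t => (D x t)^-1)
  (fun x t => - e' t * (D x t)^-2)).
- apply: near_pos t0 _ => s s0 x; apply: continuous_atV; last exact: jD.
  by rewrite gt_eqF// D_gt0.
- move=> x; have := @je' x t t0; have := @jD t t0 x => H1 H2; apply: continuous_atM.
    by cont.
  apply: continuous_atV; first by rewrite expf_neq0// gt_eqF// D_gt0.
  by cont.
- apply: near_pos t0 _ => s s0 x.
  have Dn : D x s != 0 by rewrite gt_eqF// D_gt0.
  have := is_deriveV Dn (dD x s0).
  by rewrite /GRing.scale /= mulrC mulrN mulNr.
Qed.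

(** Cauchy-Schwarz gives [V^2 <= I D * I (1 / D)], and [I D <= I F + V] since [e <= 1]. The
    resulting upper bound on [Z] is uniform in time. *)
Let IDV_gt0_bound t : 0 < t -> V ^+ 2 / (I F + V) <= I (fun x => (D x t)^-1).
Proof.
move=> t0.
have IF0 : 0 <= I F by exact: cube_integral_ge0.
set B := I F + V; have B0 : 0 < B by rewrite ltr_wpDl.
(* The tangent-line bound [1 / D >= 2 k - k^2 D] integrates to at least [2 k V - k^2 B], which is
   largest for this [k]. *)
pose k := V / B.
have : I (fun x => 2 * k - k ^+ 2 * D x t) <= I (fun x => (D x t)^-1).
  apply: le_cube_integral; [by have := @cD t; cont|exact: cDV|] => x _.
  have D0 := D_gt0 x t0.
  rewrite -subr_ge0 (_ : _ - _ = (1 - k * D x t) ^+ 2 / D x t).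
    by rewrite divr_ge0 ?sqr_ge0// ltW.
  by field; rewrite gt_eqF.
apply: le_trans.
rewrite cube_integralB; [|by cont|by have := @cD t; cont].
rewrite (cube_integralZ c l (k ^+ 2) (@cD t)).
have -> : I (D^~ t) = I F + e t * V.
  by rewrite -(cube_integral_cst l0 c) -cube_integralD//; cont.
rewrite (cube_integral_cst l0) -/V.
have : k ^+ 2 * (I F + e t * V) <= k ^+ 2 * B.
  by rewrite ler_wpM2l ?sqr_ge0// lerD2l ger_pMl ?e_le1.
rewrite (_ : k ^+ 2 * B = V ^+ 2 / B); last by rewrite /k; field; rewrite gt_eqF.
rewrite (_ : 2 * k * V = 2 * (V ^+ 2 / B)); last by rewrite /k; field; rewrite gt_eqF.
lra.
Qed.

Let IDV_gt0 t : 0 < t -> 0 < I (fun x => (D x t)^-1).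
Proof.
move=> t0; apply: lt_le_trans (IDV_gt0_bound t0).
by rewrite divr_gt0 ?exprn_gt0// ltr_wpDl// cube_integral_ge0.
Qed.

Let Z_gt0 t : 0 < t -> 0 < Z t.
Proof. by move=> t0; rewrite invr_gt0 IDV_gt0. Qed.

Let Z_le t : 0 < t -> Z t <= (I F + V) / V ^+ 2.
Proof.
move=> t0; rewrite -[leRHS]invrK lef_pV2 ?posrE ?IDV_gt0//.
  by rewrite invf_div IDV_gt0_bound.
by rewrite invr_gt0 divr_gt0 ?exprn_gt0// ltr_wpDl// cube_integral_ge0.
Qed.

Let uD t : 0 < t -> continuous (fun x => u x t ^+ 2 * D x t).
Proof. by move=> t0; have := cu t0; have := @cD t; cont. Qed.

(** Since [u] has mass 1 and [I (1 / D) = 1 / Z], the last two terms of the expanded square add up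
    to [- 2 Z + Z = - Z]. *)
Let E_sqr t : 0 < t -> I (fun x => (u x t - Z t / D x t) ^+ 2 * D x t) = E t.
Proof.
move=> t0; have cut := cu t0; have cDt := @cD t; have cDVt := cDV t0.
have cuDt := uD t0.
rewrite (eq_cube_integral _ _ (h := fun x => u x t ^+ 2 * D x t
   + (- (2 * Z t)) * u x t + Z t ^+ 2 * (D x t)^-1)); last first.
  by move=> x; field; rewrite gt_eqF ?D_gt0.
rewrite !cube_integralD; try by cont.
rewrite !cube_integralZ; try by cont.
rewrite mass// /E /relative_energy mulr1 -[I (fun x => (D x t)^-1)]invrK -/(Z t).
by field; rewrite gt_eqF ?Z_gt0.
Qed.

Let cDn t n : 0 < t -> continuous (fun x => (D x t)^- n).
Proof.
move=> t0 x; apply: continuous_atV; first by rewrite expf_neq0// gt_eqF// D_gt0.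
by have := @cD t; cont.
Qed.

Let h2 t : 0 < t -> C2 (h t).
Proof. exact: (sol_C2 su). Qed.

Let ph t : 0 < t -> Defs.periodic l (h t).
Proof.
by move=> t0 i x; rewrite /h /D pF (sol_periodic su) // ltW.
Qed.

(** The sum is the dissipation, from integrating [h] times its Laplacian by parts; the terms in [e']
    come from the weight [D] and from [Z' = e' Z^2 I (1 / D^2)]. *)
Let dE t : 0 < t -> is_derive (t : R) (1 : R) E
  (- 2 * (\sum_i I (fun x => partial i (h t) x ^+ 2))
   + e' t * (I (fun x => u x t ^+ 2) - Z t ^+ 2 * I (fun x => (D x t)^-2))).
Proof.
move=> t0; have cut := cu t0; have ch : continuous (h t) by case: (h2 t0).
have clh := C2_laplacian_continuous (h2 t0).
have dZ := is_deriveV (lt0r_neq0 (IDV_gt0 t0)) (dIDV t0).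
have := is_deriveB (dIuuD t0) dZ.
rewrite cube_integralD; try by cont.
rewrite cube_integralZ; last by cont.
rewrite (cube_integral_laplacian c l0 (h2 t0) (ph t0)) // /GRing.scale /=.
rewrite (eq_cube_integral _ _ (h := fun x => e' t * u x t ^+ 2)); last first.
  by move=> x; rewrite mulrC.
rewrite cube_integralZ; last by cont.
set S := \sum_i _; set A := I (fun x => u x t ^+ 2); set B := I (fun x => (D x t)^-2).
rewrite [X in is_derive _ _ _ X -> _](_ : _ =
   - 2 * S + e' t * (A - Z t ^+ 2 * B)); first exact.
by rewrite /Z; field; rewrite gt_eqF ?IDV_gt0.
Qed.

(* [h/D = u] has mass 1, so [m = Z] is the best constant in
   [I((h - m)^2 / D)] and [E <= I((h - m)^2 / D) <= I((h - m)^2) / e]. *)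
Let E_le_var t : 0 < t ->
  V * e t * E t <= V * I (fun x => h t x ^+ 2) - I (h t) ^+ 2.
Proof.
move=> t0; have cut := cu t0; have cDt := @cD t; have cDVt := cDV t0.
have ch : continuous (h t) by case: (h2 t0).
have cuDt := uD t0.
pose m := I (h t) / V.
have H1 : e t * I (fun x => (u x t - m / D x t) ^+ 2 * D x t) <=
    I (fun x => (h t x - m) ^+ 2).
  rewrite -cube_integralZ; last by cont.
  apply: le_cube_integral; [by cont|by cont|] => x _.
  have D0 := D_gt0 x t0.
  rewrite (_ : (h t x - m) ^+ 2 = D x t * ((u x t - m / D x t) ^+ 2 * D x t)).
    apply: ler_wpM2r; last by rewrite lerDr.
    by apply: mulr_ge0; [exact: sqr_ge0|exact: ltW].
  by rewrite /h; field; rewrite gt_eqF.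
have H2 : E t <= I (fun x => (u x t - m / D x t) ^+ 2 * D x t).
  rewrite (eq_cube_integral _ _ (h := fun x => u x t ^+ 2 * D x t
     + (- (2 * m)) * u x t + m ^+ 2 * (D x t)^-1)); last first.
    by move=> x; field; rewrite gt_eqF ?D_gt0.
  rewrite !cube_integralD; try by cont.
  rewrite !cube_integralZ; try by cont.
  rewrite mass// /E /relative_energy mulr1 -addrA lerD2l.
  rewrite -[I (fun x => (D x t)^-1)]invrK -/(Z t).
  have Zt := Z_gt0 t0.
  rewrite -subr_ge0 (_ : _ - _ = (m - Z t) ^+ 2 / Z t).
    by rewrite divr_ge0 ?sqr_ge0// ltW.
  by field; rewrite gt_eqF.
have H3 : V * I (fun x => (h t x - m) ^+ 2) =
    V * I (fun x => h t x ^+ 2) - I (h t) ^+ 2.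
  rewrite (eq_cube_integral _ _
    (h := fun x => h t x ^+ 2 + (- (2 * m)) * h t x + m ^+ 2)); last first.
    by move=> x; ring.
  rewrite !cube_integralD; try by cont.
  rewrite cube_integralZ; last by cont.
  by rewrite (cube_integral_cst l0) -/V /m; field; rewrite gt_eqF.
rewrite -H3 -mulrA ler_pM2l//; apply: le_trans H1.
by rewrite ler_pM2l// e_gt0.
Qed.

(** With [w = u - Z / D], the integrand on the left is [- w^2 - 2 w Z / D]. Young's inequality
    bounds the cross term by [delta w^2 D + Z^2 / (delta D^3)], and [D >= e] bounds the last
    quotient. *)
Let source_le t delta : 0 < t -> 0 < delta ->
  Z t ^+ 2 * I (fun x => (D x t)^-2) - I (fun x => u x t ^+ 2) <=
  delta * E t + Z t ^+ 2 / (delta * e t ^+ 3) * V.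
Proof.
move=> t0 d0; have cut := cu t0; have cDt := @cD t; have cDVt := cDV t0.
have cD2 := cDn (n := 2) t0.
rewrite -E_sqr// -(cube_integral_cst l0 c) -!cube_integralZ; try by cont.
rewrite -cube_integralB -?cube_integralD; try by cont.
apply: le_cube_integral; [by cont|by cont|] => x _.
have D0 := D_gt0 x t0; have e0 := e_gt0 t0; have Z0 := Z_gt0 t0.
have eD : e t <= D x t by rewrite lerDr.
set w := u x t - Z t / D x t.
have -> : Z t ^+ 2 * (D x t)^-2 - u x t ^+ 2 = - w ^+ 2 - 2 * w * (Z t / D x t).
  by rewrite /w; field; rewrite gt_eqF.
have H1 : Z t ^+ 2 / (delta * D x t ^+ 3) <= Z t ^+ 2 / (delta * e t ^+ 3).
  rewrite ler_wpM2l ?sqr_ge0// lef_pV2 ?posrE ?mulr_gt0 ?exprn_gt0//.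
  by rewrite ler_pM2l// lerXn2r // nnegrE ltW.
apply: le_trans (lerD (lexx _) H1).
rewrite -subr_ge0 [X in 0 <= X](_ : _ = w ^+ 2 +
   (delta * D x t ^+ 2 * w + Z t) ^+ 2 / (delta * D x t ^+ 3)).
  apply: addr_ge0; first exact: sqr_ge0.
  apply: divr_ge0; first exact: sqr_ge0.
  by apply: mulr_ge0; [exact: ltW|apply/exprn_ge0/ltW].
by field; rewrite !gt_eqF.
Qed.

Lemma relative_energy_derive : exists c0 c1 : R, [/\ 0 < c0, 0 < c1 &
  forall t, 0 < t -> exists2 dEt, is_derive (t : R) (1 : R) relative_energy dEt &
    dEt <= - (c0 * e t * relative_energy t) + c1 * (e' t ^+ 2 / e t ^+ 4)].
Proof.
have [K K0 HK] := poincare l0 d.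
have K1 : 0 < K + 1 by lra.
(* The Poincare constant may be zero, so [K + 1] is used as a positive denominator. *)
pose c0 := V / (K + 1).
have c00 : 0 < c0 by rewrite divr_gt0.
have IF0 : 0 <= I F by exact: cube_integral_ge0.
pose Zm := (I F + V) / V ^+ 2.
have Zm0 : 0 < Zm by rewrite divr_gt0 ?exprn_gt0// ltr_wpDl.
exists c0, (Zm ^+ 2 * V / c0); split => //.
  by rewrite divr_gt0// mulr_gt0// exprn_gt0.
move=> t t0; eexists; first exact: dE.
have e0 := e_gt0 t0; have e'0 := e'_lt0 t0.
have en : e t != 0 by exact: lt0r_neq0.
have e'n : e' t != 0 by rewrite lt_eqF.
have cn : c0 != 0 by exact: lt0r_neq0.
set S := \sum_i _.
have S0 : 0 <= S.
  apply: sumr_ge0 => i _; apply: cube_integral_ge0 => [|x _].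
    by case: (h2 t0) => _ _ /(_ i) cp _ _; cont.
  exact: sqr_ge0.
have HS : c0 * e t * E t <= S.
  rewrite (_ : c0 * e t * E t = V * e t * E t / (K + 1)); last first.
    by rewrite /c0; ring.
  rewrite ler_pdivrMr//.
  apply: le_trans (E_le_var t0) _.
  apply: le_trans (HK c (h t) (C2_C1 (h2 t0))) _.
  by rewrite mulrC ler_wpM2l//; lra.
(* With this choice [- e' * delta * E] equals [c0 e E], half of the available dissipation
   [2 c0 e E]. *)
pose delta := c0 * e t / - e' t.
have d0 : 0 < delta.
  by apply: divr_gt0; [exact: mulr_gt0|rewrite oppr_gt0].
have := source_le t0 d0.
set A := I _; set B := I _; move=> H.
have /(ler_wpM2l (ltW (_ : 0 < - e' t))) : Z t ^+ 2 * A - B <= delta * E t +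
    Zm ^+ 2 / (delta * e t ^+ 3) * V.
  apply: le_trans H _; rewrite lerD2l ler_pM2r// ler_pM2r.
    by rewrite lerXn2r ?Z_le// nnegrE ltW// Z_gt0.
  by rewrite invr_gt0 mulr_gt0// exprn_gt0.
rewrite oppr_gt0 => /(_ e'0).
rewrite [in leRHS]mulrDr (_ : - e' t * (delta * E t) = c0 * e t * E t); last first.
  by rewrite /delta; field; rewrite ?en ?e'n.
rewrite (_ : - e' t * (Zm ^+ 2 / (delta * e t ^+ 3) * V) =
   Zm ^+ 2 * V / c0 * (e' t ^+ 2 / e t ^+ 4)); last first.
  by rewrite /delta; field; rewrite ?en ?e'n ?cn.
rewrite -/E; lra.
Qed.

(** [D v] is periodic and harmonic, hence a constant [m] up to a function of zero mean square, and
    unit mass forces [m = Z]. So [v] may be replaced by [Z / D] under the integral. *)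
Lemma stationary_energy t (v : 'rV[R]_d -> R) : 0 < t ->
  periodic_stationary_solution (cube c l) l (D^~ t) v ->
  integral_rV (cube c l) (fun x => (u x t - v x) ^+ 2 * D x t) =
  (relative_energy t)%:E.
Proof.
move=> t0 [pv k2 lk mv]; have cut := cu t0; have cDt := @cD t.
have cDVt := cDV t0; have cuDt := uD t0.
pose k x := D x t * v x.
have ck : continuous k by case: k2.
have vE x : v x = k x * (D x t)^-1.
  by rewrite /k mulrAC mulfV ?mul1r// gt_eqF ?D_gt0.
have cv : continuous v.
  by rewrite (_ : v = fun x => k x * (D x t)^-1); [cont|exact/funext].
have pk : Defs.periodic l k by move=> i x; rewrite /k /D pF pv.
have [m Hm] := periodic_harmonic_cst c l0 k2 pk lk.
have {mv} Iv : I v = 1 by rewrite /cube_integral mv.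
have null q : continuous q -> I (fun x => (k x - m) * q x) = 0.
  by move=> cq; apply: cube_integral_sqr_eq0 Hm => //; cont.
have mE : m = Z t.
  move: Iv; rewrite (eq_cube_integral _ _
    (h := fun x => m * (D x t)^-1 + (k x - m) * (D x t)^-1)); last first.
    by move=> x; rewrite vE; ring.
  rewrite cube_integralD; try by cont.
  rewrite null// addr0 cube_integralZ// => H.
  by rewrite /Z -[m](mulfK (lt0r_neq0 (IDV_gt0 t0))) H mul1r.
rewrite integral_rV_cubeE; last by cont.
congr EFin; rewrite -/E -E_sqr//.
(* [q] is the cofactor of [k - m] in the difference of the two squared integrands, so that [null]
   removes this difference. *)
pose q x := - 2 * u x t + 2 * (m * (D x t)^-1) + (k x - m) * (D x t)^-1.
have cq : continuous q by rewrite /q; cont.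
rewrite (eq_cube_integral _ _ (h := fun x =>
  (u x t - Z t / D x t) ^+ 2 * D x t + (k x - m) * q x)); last first.
  by move=> x; rewrite vE /q -mE; field; rewrite gt_eqF ?D_gt0.
by rewrite cube_integralD ?null ?addr0//; cont.
Qed.

End energy.

(** * Decay rate *)

Section powers.
Context {R : realType}.
Implicit Types (a b s t : R).

(** Where [f] is positive, the power function is differentiable. At a zero of [f], [f x < e^(1/b)]
    gives [f x ^ b < e] directly. *)
Lemma continuous_at_powR (T : topologicalType) (f : T -> R) b (x0 : T) : 0 < b ->
  (forall x, 0 <= f x) -> continuous_at x0 f ->
  continuous_at x0 (fun x => f x `^ b).
Proof.
move=> b0 f0 cf; have := f0 x0; rewrite le_eqVlt => /predU1P[fx0|fx0].
  apply/cvgrPdist_lt => e e0; rewrite -fx0 powR0 ?gt_eqF//.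
  have e'0 : 0 < e `^ b^-1 by exact: powR_gt0.
  move/cvgrPdist_lt/(_ _ e'0) : cf; rewrite -fx0; apply: filterS => x.
  rewrite !sub0r !normrN !ger0_norm ?powR_ge0// => fx.
  have -> : e = (e `^ b^-1) `^ b.
    by rewrite -powRrM mulVf ?powRr1 ?gt_eqF// ltW.
  by apply: gt0_ltr_powR; rewrite ?nnegrE// ltW.
apply: (@continuous_comp _ _ _ f (fun y => y `^ b)) => //.
have := is_derive1_powR b fx0 => ?.
exact/differentiable_continuous/derivable1_diffP.
Qed.

Lemma continuous_at_powR1D a t : 0 < t -> continuous_at t (fun s => (1 + s) `^ a).
Proof.
move=> t0; have t1 : 0 < 1 + t by lra.
apply: (@continuous_comp _ _ _ (fun s => 1 + s) (fun y => y `^ a)).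
  by apply: continuous_atD; [exact: continuous_at_cst|exact: cvg_id].
have := is_derive1_powR a t1 => ?.
exact/differentiable_continuous/derivable1_diffP.
Qed.

Lemma is_derive_powR1D a t : 0 < t ->
  is_derive (t : R) (1 : R) (fun s => (1 + s) `^ a) (a * (1 + t) `^ (a - 1)).
Proof.
move=> t0; have t1 : 0 < 1 + t by lra.
have d1 : is_derive (t : R) (1 : R) (fun s => 1 + s) 1.
  rewrite -[X in is_derive _ _ _ X]add0r.
  exact: (is_deriveD (f := cst (1 : R))).
have := is_derive1_comp (is_derive1_powR a t1) d1.
by rewrite mulr1.
Qed.

(* [M (1 + t)^(3 alpha - 2)] is a supersolution for large [t]; the comparison
   uses the integrating factor [w = exp (int c0 (1 + t)^(-alpha))]. *)
Lemma decay_of_differential_inequality (E : R -> R) (alpha c0 c1 : R) :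
  0 < alpha -> alpha <= 1 / 2 -> 0 < c0 -> 0 < c1 ->
  (forall t, 0 < t -> exists2 dE, is_derive (t : R) (1 : R) E dE &
    dE <= - (c0 * (1 + t) `^ (- alpha) * E t) + c1 * (1 + t) `^ (2 * alpha - 2)) ->
  exists2 T : R, 0 < T & exists2 M : R, 0 < M &
    forall t, T < t -> E t <= M * (1 + t) `^ (3 * alpha - 2).
Proof.
move=> a0 a2 c00 c10 HE.
pose p := 2 - 3 * alpha; have p0 : 0 < p by rewrite /p; lra.
(* Chosen so that [T^(1 - alpha) = 2 p / c0]; beyond [T] the relative decay rate of [S] is at most
   half of the damping rate. *)
pose T := (2 * p / c0) `^ (1 - alpha)^-1.
have T0 : 0 < T by rewrite powR_gt0// divr_gt0// mulr_gt0.
have HT t : T <= t -> p * (1 + t) `^ (alpha - 1) <= c0 / 2.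
  move=> Tt; have t1 : 0 < 1 + t by lra.
  have : 2 * p / c0 <= (1 + t) `^ (1 - alpha).
    rewrite (_ : 2 * p / c0 = T `^ (1 - alpha)); last first.
      by rewrite /T -powRrM mulVf ?powRr1 ?divr_ge0 ?mulr_ge0 ?ltW//; lra.
    by apply: ge0_ler_powR; rewrite ?nnegrE; lra.
  have q0 : 0 < (1 + t) `^ (1 - alpha) by exact: powR_gt0.
  rewrite ler_pdivrMr// -[alpha - 1]opprB powRN ler_pdivrMr//; lra.
(* The first term makes [M c0 / 2] dominate the source constant [c1]; the second gives
   [E T <= S T]. *)
pose M := 2 * c1 / c0 + `|E T| * (1 + T) `^ p.
have M1 : 2 * c1 / c0 <= M by rewrite lerDl mulr_ge0// powR_ge0.
have M0 : 0 < M by apply: lt_le_trans M1; rewrite divr_gt0// mulr_gt0.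
exists T => //; exists M => // t Tt.
pose S s := M * (1 + s) `^ (- p).
pose w s := expR (c0 / (1 - alpha) * (1 + s) `^ (1 - alpha)).
pose phi s := (E s - S s) * w s.
have dphi s : T <= s -> exists2 y, y <= 0 & is_derive (s : R) (1 : R) phi y.
  move=> Ts; have s0 : 0 < s by lra.
  have s1 : 0 < 1 + s by lra.
  have [y dE ley] := HE s s0.
  have dS : is_derive (s : R) (1 : R) S (M * (- p * (1 + s) `^ (- p - 1))).
    exact: (is_deriveZ (f := fun s => (1 + s) `^ (- p)) M (is_derive_powR1D (- p) s0)).
  have dw : is_derive (s : R) (1 : R) w (w s * (c0 * (1 + s) `^ (- alpha))).
    have := is_derive1_comp (is_derive_expR _) (is_deriveZ
       (f := fun s => (1 + s) `^ (1 - alpha)) (c0 / (1 - alpha))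
       (is_derive_powR1D (1 - alpha) s0)).
    rewrite /GRing.scale /= (_ : c0 / (1 - alpha) * _ = c0 * (1 + s) `^ (- alpha)) //.
    rewrite addrAC subrr add0r; field; lra.
  have dd := is_deriveM (is_deriveB dE dS) dw.
  eexists; last exact: dd.
  rewrite /GRing.scale /= (_ : (E - S) s = E s - S s) //.
  rewrite [X in X <= 0](_ : _ = w s * (y - M * (- p * (1 + s) `^ (- p - 1)) +
     c0 * (1 + s) `^ (- alpha) * (E s - S s))); last ring.
  have w0 : 0 < w s by exact: expR_gt0.
  rewrite pmulr_rle0//.
  have E1 : (1 + s) `^ (- alpha) * (1 + s) `^ (- p) = (1 + s) `^ (2 * alpha - 2).
    rewrite -powRD; last by rewrite (lt0r_neq0 s1) implybT.
    by congr (_ `^ _); rewrite /p; ring.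
  have E2 : (1 + s) `^ (- p - 1) = (1 + s) `^ (alpha - 1) * (1 + s) `^ (2 * alpha - 2).
    rewrite -powRD; last by rewrite (lt0r_neq0 s1) implybT.
    by congr (_ `^ _); rewrite /p; ring.
  have E3 : c0 * (1 + s) `^ (- alpha) * S s = c0 * M * (1 + s) `^ (2 * alpha - 2).
    by rewrite -E1 /S; ring.
  rewrite E2 mulrBr E3.
  have := HT s Ts.
  have q0 : 0 < (1 + s) `^ (2 * alpha - 2) by exact: powR_gt0.
  move: ley q0; set q := _ `^ (2 * alpha - 2); set r := _ `^ (alpha - 1).
  move=> ley q0 Hr.
  (* The damping [c0 M q] of the supersolution is split in two halves: one pays for its own decay,
     the other for the source [c1 q]. *)
  have h1 : M * q * (p * r) <= M * q * (c0 / 2) by rewrite ler_wpM2l// mulr_ge0// ltW.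
  have h2 : c1 * q <= M * q * (c0 / 2).
    have : 2 * c1 <= M * c0 by rewrite -ler_pdivrMr.
    by move=> ?; nra.
  lra.
have cphi s : T <= s -> continuous_at s phi.
  by move=> /dphi[y _ ?]; apply/differentiable_continuous/derivable1_diffP.
have [||s] := @MVT_segment R phi (fun s => 'D_1 phi s) T t (ltW Tt).
- move=> s; rewrite in_itv /= => /andP[/ltW/dphi[y _ ?] _].
  by apply: DeriveDef => //; exact: ex_derive.
- apply: continuous_in_subspaceT => s; rewrite inE /= in_itv /= => /andP[? _].
  exact: cphi.
rewrite in_itv /= => /andP[Ts st] E3.
have : phi t - phi T <= 0.
  rewrite E3; have [y y0 ?] := dphi s Ts; rewrite derive_val.
  by rewrite mulr_le0_ge0// subr_ge0 ltW.
have phiT : phi T <= 0.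
  have T1 : 0 < 1 + T by lra.
  have pp : (1 + T) `^ p * (1 + T) `^ (- p) = 1.
    by rewrite powRN mulfV// lt0r_neq0// powR_gt0.
  rewrite /phi mulr_le0_ge0 ?expR_ge0// subr_le0 /S /M mulrDl.
  rewrite -[X in _ + X]mulrA pp mulr1; apply: le_trans (ler_norm _) _.
  rewrite lerDr; apply: mulr_ge0; last exact: powR_ge0.
  by rewrite divr_ge0 ?mulr_ge0// ltW.
move=> H; have : phi t <= 0 by lra.
rewrite /phi pmulr_lle0 ?expR_gt0// subr_le0 /S => /le_trans; apply.
by rewrite (_ : - p = 3 * alpha - 2)// /p; ring.
Qed.

End powers.

(** * From energy decay to the weighted norm, for [eps] a power of [1 + t] *)

Unset Implicit Arguments.

Theorem theorem2p2 (R : realType) (d : nat) (c : 'rV[R]_d) (l : R)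
    (f : 'rV[R]_d -> R) (xs : 'rV[R]_d) (beta alpha : R)
    (u0 : 'rV[R]_d -> R) (u ubar : 'rV[R]_d -> R -> R) :
  let Om := cube c l in
  let D := Deps f (f xs) beta alpha in
  let gamma := 1 - (d%:R / (2 * beta) + 3 / 2) * alpha in
  (0 < d)%N -> 0 < l ->
  assumption_A1 Om l f xs -> assumption_A2 Om f xs -> assumption_A3 Om f xs ->
  d%:R / 2 <= beta ->
  0 < alpha -> alpha <= 1 / 2 -> alpha < 2 * beta / (d%:R + 3 * beta) ->
  probability_density Om l u0 ->
  periodic_solution Om l D u0 u ->
  (forall t : R, 0 <= t -> integral_rV Om (u ^~ t) = 1%:E) ->
  (forall t : R, 0 < t ->
    periodic_stationary_solution Om l (D ^~ t) (ubar ^~ t)) ->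
  0 < gamma /\
  exists2 t0 : R, 0 < t0 &
    exists2 C : R, 0 < C &
      forall t : R, t0 < t ->
        (weighted_L2 Om (D ^~ t) (fun x => (u x t - ubar x t)%R)
           <= (C * t `^ (- gamma))%:E)%E.
Proof.
move=> Om D gamma d0 l0 [[cf _ _ _ _] pf [_ fmin _] _] _ _ dbeta a0 a2 abeta _.
move=> su mass stat.
have d1 : 1 <= d%:R :> R by rewrite ler1n.
have beta0 : 0 < beta by lra.
(* The energy estimate yields the exponent on the right, which exceeds [gamma] by
   [d / (2 beta) * alpha]. *)
have slow : gamma <= 1 - 3 / 2 * alpha.
  rewrite /gamma mulrDl opprD addrA lerD2r gerDl oppr_le0.
  by rewrite mulr_ge0 ?divr_ge0 ?mulr_ge0// ltW.
(* Over a common denominator, [d / (2 beta) + 3 / 2 = (d + 3 beta) / (2 beta)], so this is the upper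
   bound on [alpha] rewritten. *)
have gamma0 : 0 < gamma.
  rewrite subr_gt0 (_ : _ * alpha = alpha * (d%:R + 3 * beta) / (2 * beta)).
    rewrite ltr_pdivrMr ?mul1r -?ltr_pdivlMr//; lra.
  by field; rewrite gt_eqF.
split => //.
pose F x := (f x - f xs) `^ beta.
have f0 x : 0 <= f x - f xs by rewrite subr_ge0.
have cF : continuous F.
  by move=> x; apply: continuous_at_powR => //; cont.
have F0 x : 0 <= F x by exact: powR_ge0.
have pF : Defs.periodic l F by move=> i x; rewrite /F pf.
pose e' (t : R) : R := - alpha * (1 + t) `^ (- alpha - 1).
have e0 (t : R) : 0 < t -> 0 < eps alpha t by move=> t0; apply: powR_gt0; lra.
have e1 (t : R) : 0 < t -> eps alpha t <= 1.
  move=> t0; rewrite /eps -[leRHS](@powRr0 _ (1 + t)); apply: ler_powR; lra.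
have de (t : R) : 0 < t -> is_derive (t : R) (1 : R) (eps alpha) (e' t).
  exact: is_derive_powR1D.
have ce' (t : R) : 0 < t -> {for t, continuous e'}.
  by move=> t0; have := continuous_at_powR1D (a := - alpha - 1) t0; rewrite /e'; cont.
have e'0 (t : R) : 0 < t -> e' t < 0.
  by move=> t0; rewrite /e' mulNr oppr_lt0 mulr_gt0// powR_gt0//; lra.
have mass' (t : R) : 0 < t -> cube_integral c l (u^~ t) = 1.
  by move=> t0; rewrite /cube_integral mass// ltW.
have [c0 [c1 [c00 c10 HE]]] :=
  relative_energy_derive l0 cF F0 pF e0 e1 de ce' e'0 su mass'.
set E := relative_energy c l F (eps alpha) u in HE.
have [T T0 [M M0 HM]] : exists2 T : R, 0 < T & exists2 M : R, 0 < M &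
    forall t, T < t -> E t <= M * (1 + t) `^ (3 * alpha - 2).
  apply: (decay_of_differential_inequality (c1 := c1 * alpha ^+ 2) a0 a2 c00).
    by rewrite mulr_gt0// exprn_gt0.
  move=> t t0; have [y dE ley] := HE t t0; exists y => //.
  have t1 : 0 < 1 + t by lra.
  apply: le_trans ley _; rewrite lerD2l /e' /eps -[c1 * _ * _]mulrA ler_pM2l// le_eqVlt.
  apply/orP; left; apply/eqP.
  (* The exponents of [e'^2 / e^4] add up to [2 (- alpha - 1) + 4 alpha = 2 alpha - 2]. *)
  rewrite exprMn sqrrN -mulrA; congr (_ * _).
  rewrite -!powR_mulrn ?powR_ge0// -!powRrM -powRN -powRD; last first.
    by rewrite (lt0r_neq0 t1) implybT.
  by congr (_ `^ _); ring.
exists T => //; exists (M `^ 2^-1); first exact: powR_gt0.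
move=> t Tt; have t0 : 0 < t by lra.
have EI := stationary_energy l0 cF F0 pF e0 e1 su mass' t0 (stat t t0).
(* Nonnegativity of the energy is needed for the monotonicity of the square root. *)
have E0 : 0 <= E t.
  rewrite -lee_fin -EI; apply: integral_ge0 => s _; rewrite lee_fin.
  by rewrite mulr_ge0 ?sqr_ge0// addr_ge0// ltW// e0.
rewrite /weighted_L2 EI poweR_EFin lee_fin.
apply: (@le_trans _ _ ((M * (1 + t) `^ (3 * alpha - 2)) `^ 2^-1)).
  apply: ge0_ler_powR; rewrite ?nnegrE ?invr_ge0 ?mulr_ge0 ?powR_ge0 ?(ltW M0)//.
  exact: HM.
rewrite powRM ?powR_ge0 ?(ltW M0)// ler_wpM2l ?powR_ge0// -powRrM.
apply: (@le_trans _ _ ((1 + t) `^ (- gamma))).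
  apply: ler_powR; lra.
(* As the exponent [- gamma] is negative, replacing [1 + t] by the smaller [t] increases the
   bound. *)
rewrite !powRN lef_pV2 ?posrE ?powR_gt0//; last lra.
by apply: ge0_ler_powR; rewrite ?nnegrE; lra.
Qed.
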